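(* Let $I=[0,T]$, $T>0$. For every $t\in I$ let $A(t):D(A(t))\subset\mathbb R^e\rightrightarrows\mathbb R^e$ be a maximal monotone operator, and assume: (H1) (with $r$ continuous) there is a continuous nondecreasing function $r:I\to[0,+\infty[$ with $r(0)=0$ and $r(T)<+\infty$ such that $dis(A(t),A(s))\le dr(]s,t])=r(t)-r(s)$ for $0\le s\le t\le T$; (H2) there is a nonnegative real constant $c$ such that $\|A^0(t,x)\|\le c(1+\|x\|)$ for all $t\in I$, $x\in D(A(t))$. Let $z\in C^{1\text{-}var}(I,\mathbb R^d)$, the space of continuous functions of bounded variation on $I$ with values in $\mathbb R^d$. Let $\mathcal L(\mathbb R^d,\mathbb R^e)$ be the space of linear mappings from $\mathbb R^d$ to $\mathbb R^e$ with the operator norm $\|f\|_{\mathcal L}=\sup_{x\in\overline B_{\mathbb R^d}}\|f(x)\|_{\mathbb R^e}$. Let $b:I\times\mathbb R^e\to\mathcal L(\mathbb R^d,\mathbb R^e)$ be continuous and satisfy, for a nonnegative constant $M$: (a) $\|b(t,x)\|_{\mathcal L}\le M$ for all $(t,x)\in I\times\mathbb R^e$; (b) $\|b(t,x)-b(t,y)\|_{\mathcal L}\le M\|x-y\|_{\mathbb R^e}$ for all $(t,x,y)\in I\times\mathbb R^e\times\mathbb R^e$. Let $a\in D(A(0))$. Then there exist a BVC function $X:I\to\mathbb R^e$ and a BVC function $Y:I\to\mathbb R^e$ satisfying $$\begin{cases}X(0)=Y(0)=a;\\ X(t)=\int_0^t b(\tau,X(\tau))\,dz_\tau+Y(t)\quad\forall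 t\in I;\\ -\frac{dY}{d\nu}(t)\in A(t)Y(t)+\Big(\int_0^t b(\tau,X(\tau))\,dz_\tau\Big)\frac{d\lambda}{d\nu}(t)\quad\nu\text{-a.e. }t\in I,\end{cases}$$ where $\int_0^t b(\tau,X(\tau))\,dz_\tau$ denotes the Riemann-Stieltjes integral of the continuous function $b(\cdot,X(\cdot))$ with respect to $z$.
   Context: $\lambda$ is Lebesgue measure on $I$. BVC means continuous and of bounded variation. $\overline B_{\mathbb R^d}$ is the closed unit ball. For a maximal monotone operator $A(t)$, $D(A(t))$ is its domain and $A^0(t,x)$ is the projection of the origin on the closed convex set $A(t)x$. The pseudo-distance between maximal monotone operators $A,B$ is $$dis(A,B)=\sup\Big\{\frac{\langle y-y',x'-x\rangle}{1+\|y\|+\|y'\|}:\ x\in D(A),\,y\in Ax,\,x'\in D(B),\,y'\in Bx'\Big\}.$$ $dr$ is the Stieltjes measure on $I$ associated with $r$ (so $dr(]s,t])=r(t)-r(s)$), $\nu:=\lambda+dr$, and $\frac{d\lambda}{d\nu}$ is the density of $\lambda$ with respect to $\nu$. $\frac{dY}{d\nu}$ denotes the density with respect to $\nu$ of the differential measure $dY$ of $Y$ ($dY(]s,t])=Y(t)-Y(s)$), i.e. $Y(t)=Y(0)+\int_{]0,t]}\frac{dY}{d\nu}\,d\nu$; its existence is part of the conclusion. *)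

(* Defs.v *)
From HB Require Import structures.
From mathcomp Require Import all_boot all_order all_algebra.
From mathcomp Require Import all_classical all_reals all_analysis.
From mathcomp Require Import lra.

Set Implicit Arguments.
Unset Strict Implicit.
Unset Printing Implicit Defensive.

Import Order.TTheory GRing.Theory Num.Theory.
Import numFieldNormedType.Exports.

Local Open Scope classical_set_scope.
Local Open Scope ring_scope.

(* Vectors of R^n are the columns 'cV[R]_n and linear maps R^d -> R^e are the
   matrices 'M[R]_(e, d) acting by *m.  The library norm `|u| on these types is
   the max norm: it gives the usual topology, but metric statements use the
   Euclidean norm [enorm] and the induced operator norm [opnorm] instead. *)
Section euclidean.
Variable R : realType.

Definition dotv n (u v : 'cV[R]_n) : R := \sum_(i < n) u i 0 * v i 0.

Definition enorm n (u : 'cV[R]_n) : R := Num.sqrt (dotv u u).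

Definition opnorm d e (f : 'M[R]_(e, d)) : R :=
  sup [set enorm (f *m x) | x in [set x : 'cV[R]_d | enorm x <= 1]].

(* The metric projection of u on S; it is 0 by convention when no nearest
   point exists, which cannot happen for S closed, convex and nonempty. *)
Definition metric_proj n (S : set 'cV[R]_n) (u : 'cV[R]_n) : 'cV[R]_n :=
  xget 0 [set p | S p /\ forall q, S q -> enorm (u - p) <= enorm (u - q)].

End euclidean.

Section operators.
Variables (R : realType) (n : nat).
Local Notation E := 'cV[R]_n.

(* A x is the (possibly empty) set of values of the multivalued operator A. *)
Definition operator := E -> set E.

Implicit Types A B : operator.

Definition domain A : set E := [set x | A x !=set0].

Definition monotone A := forall x y x' y', A x y -> A x' y' ->
  0 <= dotv (y - y') (x - x').

Definition maximal_monotone A := monotone A /\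
  forall B, monotone B -> (forall x, A x `<=` B x) -> forall x, B x `<=` A x.

Definition minimal_section A (x : E) : E := metric_proj (A x) 0.

Definition dis A B : \bar R := ereal_sup
  [set q | exists x y x' y', [/\ A x y, B x' y' &
     q = (dotv (y - y') (x' - x) / (1 + enorm y + enorm y'))%:E]].

End operators.

Section curves.
Variable R : realType.

Definition bounded_variation_vec n (a b : R) (f : R -> 'cV[R]_n) :=
  exists V : R, forall s, itv_partition a b s ->
    let p := nth b (a :: s) in
    \sum_(0 <= i < size s) enorm (f (p i.+1) - f (p i)) <= V.

Definition BVC n (a b : R) (f : R -> 'cV[R]_n) :=
  {within `[a, b], continuous f} /\ bounded_variation_vec a b f.

(* v is the limit, as the mesh tends to 0, of the sums of
   f(tau_i) (z(p_(i+1)) - z(p_i)), uniformly in the tags tau_i. *)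
Definition is_RS_integral d e (f : R -> 'M[R]_(e, d)) (z : R -> 'cV[R]_d)
    (a b : R) (v : 'cV[R]_e) :=
  forall eps : R, 0 < eps -> exists2 delta : R, 0 < delta &
    forall (s : seq R) (tau : nat -> R), itv_partition a b s ->
      let p := nth b (a :: s) in
      (forall i, (i < size s)%N ->
         p i.+1 - p i < delta /\ p i <= tau i <= p i.+1) ->
      enorm (\sum_(0 <= i < size s) f (tau i) *m (z (p i.+1) - z (p i)) - v)
        < eps.

End curves.

Section measures.
Variables (R : realType) (T : R) (T0 : 0 < T) (r : R -> R).
Hypothesis rc : {within `[0, T], continuous r}.
Hypothesis rnd : {in `[0, T] &, nondecreasing_fun r}.

Definition clamp (t : R) : R := Num.max 0 (Num.min t T).

Lemma clamp_itv t : clamp t \in `[0, T].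
Proof.
by rewrite in_itv /= /clamp le_max lexx /= ge_max (ltW T0) ge_min lexx orbT.
Qed.

Lemma clampE t : t \in `[0, T] -> clamp t = t.
Proof.
rewrite in_itv /= => /andP[t0 tT]; rewrite /clamp (min_l tT).
by rewrite (max_r t0).
Qed.

Lemma clamp_continuous : continuous clamp.
Proof.
move=> x; apply: (@continuous_max _ _ (cst 0) (fun t => Num.min t T)).
  exact: cvg_cst.
by apply: (@continuous_min _ _ id (cst T)); [exact: cvg_id | exact: cvg_cst].
Qed.

(* The extension of r to the line by r 0 on the left and r T on the right;
   its Stieltjes measure lives on [0, T].  The proof arguments only serve to
   attach the cumulative structure. *)
Definition extend of 0 < T & {within `[0, T], continuous r} &
  {in `[0, T] &, nondecreasing_fun r} := r \o clamp.

Let extend_nd : nondecreasing (extend T0 rc rnd).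
Proof.
move=> x y xy; rewrite /extend /=; apply: rnd; [exact: clamp_itv..|].
by rewrite /clamp le_max2// le_min2.
Qed.

Let extend_rc : right_continuous (extend T0 rc rnd).
Proof.
apply: right_continuousW => x.
have /subspace_continuousP/(_ _ (clamp_itv x)) rx := rc.
apply: (cvg_trans _ rx); move=> P /= wP.
have {}wP : nbhs (clamp x) [set y | y \in `[0, T] -> P (r y)] := wP.
have := @clamp_continuous x _ wP; rewrite /extend.
by apply: (@filterS _ (nbhs x)) => y /(_ (clamp_itv y)).
Qed.

HB.instance Definition _ :=
  isCumulative.Build R _ R (extend T0 rc rnd) extend_nd extend_rc.

Definition stieltjes : {measure set (measurableTypeR R) -> \bar R} :=
  lebesgue_stieltjes_measure (extend T0 rc rnd).

Lemma stieltjes_itv s t : 0 <= s -> s <= t -> t <= T ->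
  stieltjes `]s, t]%classic = (r t - r s)%:E.
Proof.
move=> s0 st tT.
rewrite /stieltjes /= /lebesgue_stieltjes_measure /measure_extension.
rewrite measurable_mu_extE /=; last exact: is_ocitv.
rewrite wlength_itv_bnd// /extend /= !clampE// in_itv /=.
  by rewrite s0 (le_trans st).
by rewrite tT (le_trans s0).
Qed.

Lemma lebesgue_itv_lty :
  (lebesgue_measure (`[0%R, T]%classic : set (measurableTypeR R)) < +oo)%E.
Proof. by rewrite lebesgue_measure_itv /=; case: ifP; rewrite ?ltry. Qed.

Lemma stieltjes_itv_lty : (stieltjes `[0%R, T]%classic < +oo)%E.
Proof.
have sub : `[0, T]%classic `<=` `](-1), T]%classic.
  by move=> x /=; rewrite !in_itv /= => /andP[x0 ->]; rewrite andbT; lra.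
apply: (@le_lt_trans _ _ (stieltjes `](-1), T]%classic)).
  by apply: le_measure => //; rewrite inE; exact: measurable_itv.
rewrite /stieltjes /= /lebesgue_stieltjes_measure /measure_extension.
rewrite measurable_mu_extE /=; last exact: is_ocitv.
by rewrite wlength_itv /=; case: ifP; rewrite ?ltry.
Qed.

(* lambda, dr and nu = lambda + dr, as finite measures on the line that vanish
   outside [0, T]. *)
Definition lambda : {finite_measure set (measurableTypeR R) -> \bar R} :=
  @mfrestr _ (measurableTypeR R) R _ lebesgue_measure
    (measurable_itv `[0, T]) lebesgue_itv_lty.

Definition dr : {finite_measure set (measurableTypeR R) -> \bar R} :=
  @mfrestr _ (measurableTypeR R) R _ stieltjes
    (measurable_itv `[0, T]) stieltjes_itv_lty.

Definition nu : set (measurableTypeR R) -> \bar R := measure_add lambda dr.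

HB.instance Definition _ := Measure.on nu.

Let nu_fin : fin_num_fun nu.
Proof.
by move=> U mU; rewrite /nu measure_addE fin_numD !fin_num_measure.
Qed.

HB.instance Definition _ := Measure_isFinite.Build _ _ _ nu nu_fin.

(* [Radon_Nikodym] is meaningful only under domination; the lemma ensures it. *)
Lemma lambda_dominated : charge_of_finite_measure lambda `<< nu.
Proof.
apply/null_content_dominatesP => U mU.
rewrite /= /nu measure_addE => /eqP.
by rewrite padde_eq0 ?measure_ge0// => /andP[/eqP].
Qed.

Definition dlambda_dnu (t : R) : R :=
  fine (Radon_Nikodym (charge_of_finite_measure lambda) nu t).

End measures.

(* g is a density with respect to mu of the differential measure of Y on
   [0, T]; vector integrals are computed coordinatewise. *)
Definition is_density (R : realType) n (T : R)
    (mu : {measure set (measurableTypeR R) -> \bar R}) (Y g : R -> 'cV[R]_n) :=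
  (forall i, mu.-integrable `[0, T] (fun s => (g s i 0)%:E)) /\
  forall t, t \in `[0, T] ->
    Y t = Y 0 + \col_(i < n) \int[mu]_(s in `]0, t]) g s i 0.

(* Main.v *)
Require Import Defs.
From HB Require Import structures.
From mathcomp Require Import all_boot all_order all_algebra.
From mathcomp Require Import all_classical all_reals all_analysis.
From mathcomp Require Import measurable_realfun ring lra.

Set Implicit Arguments.
Unset Strict Implicit.
Unset Printing Implicit Defensive.

Import Order.TTheory GRing.Theory Num.Theory.
Import numFieldNormedType.Exports.

Local Open Scope classical_set_scope.
Local Open Scope ring_scope.

(** [X], [Y] and [J = X - Y] are limits of a catching-up scheme on the uniform
    grids of [0, T], implicit in [Y] (each step is a resolvent of [A], given by
    Minty's theorem) and explicit in [J].  Testing a step against the minimal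
    section at the previous point bounds the speeds of [Y] by a constant times
    the increments of [v t = t + r t], uniformly in the mesh, while [J] is
    controlled by the variation of [z].  The approximations therefore converge
    pointwise along an ultrafilter on the integers, so that no subsequence is
    extracted, and a common modulus of continuity makes [J] the
    Riemann-Stieltjes integral.  The scheme also passes an energy inequality (an
    integral solution in the sense of Benilan) to the limit; dividing it by the
    increment of [v] at a point where [Y] and the identity have derivatives with
    respect to [nu] gives the inclusion, by maximality.  Differentiation with
    respect to [nu] is Lebesgue differentiation after the change of time
    [v^-1]. *)

(** * Euclidean space and ultrafilters *)

(** The speeds [y] are only known to be bounded, and the operator changes from step to step, so the
    inclusions satisfied by the scheme are not passed to the limit one by one. What survives is the
    squared distance from [Y] to a fixed test point: a pair [(xi, eta)] of the graph of [A s] can be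
    tested against later operators at the price [r t - r s] given by (H1). In the energy inequality
    this price is multiplied by the increment of [v], so it still vanishes after the division. In
    the scheme, [y] is weighted by an increment of [v] and [J] by one of time. The former dominates
    both the time step and the distance between consecutive operators, which is what bounds the
    speeds; in the limit the weights become the densities 1 and [dlambda_dnu]. Keeping [J] explicit
    leaves a single resolvent to solve, and the bound on [b] controls [J] before anything is known
    about [Y]. Convergence is only pointwise; uniform information comes from [v] and from a modulus
    [w] of [z], whose increments dominate those of [Y] and [J] at every mesh. *)

Lemma ler_cvg (R : realType) (T : Type) (F : set_system T) {FF : ProperFilter F}
    (f g : T -> R) (a b : R) :
  f t @[t --> F] --> a -> g t @[t --> F] --> b ->
  (\forall t \near F, f t <= g t) -> a <= b.
Proof.
move=> fa gb fg; rewrite -subr_ge0.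
apply: (@closed_cvg _ _ F FF (fun t => g t - f t) _ (@closed_ge R 0) _ (b - a)).
  by apply: filterS fg => t; rewrite /= subr_ge0.
exact: cvgB.
Qed.

Lemma cvg_sumr (R : realType) (V : normedModType R) (T : Type)
    (F : set_system T) {FF : Filter F} (I : Type) (s : seq I) (f : I -> T -> V)
    (l : I -> V) :
  (forall i, f i t @[t --> F] --> l i) ->
  \sum_(i <- s) f i t @[t --> F] --> \sum_(i <- s) l i.
Proof.
by move=> fl; apply: cvg_big => [|i _]; [exact: add_continuous|exact: fl].
Qed.

Section euclidean_space.
Variables (R : realType) (n : nat).
Implicit Types u v w : 'cV[R]_n.

Lemma dotvC u v : dotv u v = dotv v u.
Proof. by apply: eq_bigr => i _; rewrite mulrC. Qed.

Lemma dotvDl u v w : dotv (u + v) w = dotv u w + dotv v w.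
Proof. by rewrite -big_split; apply: eq_bigr => i _; rewrite mxE mulrDl. Qed.

Lemma dotvZl k u v : dotv (k *: u) v = k * dotv u v.
Proof. by rewrite mulr_sumr; apply: eq_bigr => i _; rewrite mxE mulrA. Qed.

Lemma dotv0l v : dotv 0 v = 0.
Proof. by rewrite -(scale0r 0) dotvZl mul0r. Qed.

Lemma dotvNl u v : dotv (- u) v = - dotv u v.
Proof. by rewrite -scaleN1r dotvZl mulN1r. Qed.

Lemma dotvBl u v w : dotv (u - v) w = dotv u w - dotv v w.
Proof. by rewrite dotvDl dotvNl. Qed.

Lemma dotvDr u v w : dotv w (u + v) = dotv w u + dotv w v.
Proof. by rewrite !(dotvC w) dotvDl. Qed.

Lemma dotvZr k u v : dotv u (k *: v) = k * dotv u v.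
Proof. by rewrite !(dotvC u) dotvZl. Qed.

Lemma dotvNr u v : dotv u (- v) = - dotv u v.
Proof. by rewrite !(dotvC u) dotvNl. Qed.

Definition dotvE := (dotvDl, dotvDr, dotvNl, dotvNr, dotvZl, dotvZr).

Lemma dotv_suml (I : Type) (s : seq I) (P : pred I) (F : I -> 'cV[R]_n) v :
  dotv (\sum_(i <- s | P i) F i) v = \sum_(i <- s | P i) dotv (F i) v.
Proof.
apply: (big_morph (fun u => dotv u v)) => [? ?|]; first exact: dotvDl.
by rewrite -(scale0r 0) dotvZl mul0r.
Qed.

Lemma dotv_ge0 u : 0 <= dotv u u.
Proof. by apply: sumr_ge0 => i _; rewrite -expr2 sqr_ge0. Qed.

Lemma dotv_eq0 u : dotv u u = 0 -> u = 0.
Proof.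
move=> /eqP; rewrite psumr_eq0 => [/allP u0|i _]; last by rewrite -expr2 sqr_ge0.
apply/colP => i; have := u0 i (mem_index_enum _).
by rewrite /= mulf_eq0 orbb mxE => /eqP.
Qed.

Lemma sqr_enorm u : enorm u ^+ 2 = dotv u u.
Proof. by rewrite sqr_sqrtr// dotv_ge0. Qed.

Lemma enorm_ge0 u : 0 <= enorm u.
Proof. exact: sqrtr_ge0. Qed.

Lemma enorm0 : enorm (0 : 'cV[R]_n) = 0.
Proof. by rewrite /enorm -(scale0r 0) dotvZl mul0r sqrtr0. Qed.

Lemma enorm_eq0 u : enorm u = 0 -> u = 0.
Proof. by move=> u0; apply: dotv_eq0; rewrite -sqr_enorm u0 expr0n. Qed.

Lemma enormZ k u : enorm (k *: u) = `|k| * enorm u.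
Proof.
by rewrite /enorm dotvZl dotvZr mulrA -expr2 sqrtrM ?sqr_ge0// sqrtr_sqr.
Qed.

Lemma enormN u : enorm (- u) = enorm u.
Proof. by rewrite -scaleN1r enormZ normrN1 mul1r. Qed.

Lemma enormB u v : enorm (u - v) = enorm (v - u).
Proof. by rewrite -enormN opprB. Qed.

(** Cauchy-Schwarz: the square of [dotv v v *: u - dotv u v *: v] is [dotv v v] times the Gram
    determinant of [u] and [v]. *)
Lemma dotv_le_enorm u v : dotv u v <= enorm u * enorm v.
Proof.
have [v0|v0] := eqVneq (dotv v v) 0.
  by rewrite (dotv_eq0 v0) enorm0 mulr0 dotvC -(scale0r 0) dotvZl mul0r.
have vv : 0 < dotv v v by rewrite lt_neqAle eq_sym v0 dotv_ge0.
have : 0 <= dotv (dotv v v *: u - dotv u v *: v) (dotv v v *: u - dotv u v *: v).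
  exact: dotv_ge0.
rewrite !dotvE (dotvC v u) => h.
have {}h : 0 <= dotv v v * (dotv u u * dotv v v - dotv u v ^+ 2).
  by rewrite (le_trans h)// le_eqVlt; apply/orP; left; apply/eqP; ring.
rewrite pmulr_rge0// subr_ge0 -!sqr_enorm -exprMn in h.
have [uv|uv] := leP (dotv u v) 0.
  by rewrite (le_trans uv)// mulr_ge0// enorm_ge0.
by rewrite -ler_sqr ?nnegrE ?mulr_ge0 ?enorm_ge0 ?(ltW uv).
Qed.

Lemma normr_dotv u v : `|dotv u v| <= enorm u * enorm v.
Proof.
rewrite ler_norml dotv_le_enorm andbT lerNl -dotvNl -(enormN u).
exact: dotv_le_enorm.
Qed.

Lemma enormD u v : enorm (u + v) <= enorm u + enorm v.
Proof.
rewrite -ler_sqr ?nnegrE ?addr_ge0 ?enorm_ge0//.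
rewrite sqr_enorm !dotvE sqrrD !sqr_enorm (dotvC v u).
by have := dotv_le_enorm u v; lra.
Qed.

Lemma enormBD u v w : enorm (u - w) <= enorm (u - v) + enorm (v - w).
Proof. by rewrite -(subrKA v u (- w)) enormD. Qed.

Lemma enorm_sum (I : Type) (s : seq I) (P : pred I) (F : I -> 'cV[R]_n) :
  enorm (\sum_(i <- s | P i) F i) <= \sum_(i <- s | P i) enorm (F i).
Proof.
elim/big_rec2: _ => [|i y x _ xy]; first by rewrite enorm0.
by rewrite (le_trans (enormD _ _))// lerD2l.
Qed.

Lemma normr_coord_le_enorm u i : `|u i 0| <= enorm u.
Proof.
rewrite -sqrtr_sqr /enorm ler_wsqrtr// /dotv (bigD1 i)//= expr2 lerDl.
by apply: sumr_ge0 => j _; rewrite -expr2 sqr_ge0.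
Qed.

Lemma enorm_le_sum u : enorm u <= \sum_i `|u i 0|.
Proof.
have {1}-> : u = \sum_i u i 0 *: delta_mx i 0.
  rewrite {1}[u]matrix_sum_delta; apply: eq_bigr => i _.
  by rewrite big_ord1.
apply: (le_trans (enorm_sum _ _ _)); apply: ler_sum => i _.
rewrite enormZ ler_piMr// /enorm /dotv (bigD1 i)//= big1.
  by rewrite mxE !eqxx mulr1 addr0 sqrtr1.
by move=> j ji; rewrite !mxE (negbTE ji) mul0r.
Qed.

Lemma cvg_cV (T : Type) (F : set_system T) {FF : Filter F}
    (u : T -> 'cV[R]_n) (l : 'cV[R]_n) :
  (forall i, u t i 0 @[t --> F] --> l i 0) -> u t @[t --> F] --> l.
Proof.
move=> ul; apply/cvg_ballP => e e0; rewrite near_simpl.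
have : \forall t \near F, forall i, ball (l i 0) e (u t i 0).
  by apply: filter_forall => i; exact: (cvg_ball (ul i)).
by apply: filterS => t h; split => // i j; rewrite !ord1.
Qed.

Lemma cvg_cV_coord (T : Type) (F : set_system T) {FF : Filter F}
    (u : T -> 'cV[R]_n) (l : 'cV[R]_n) i :
  u t @[t --> F] --> l -> u t i 0 @[t --> F] --> l i 0.
Proof.
move=> ul; apply: (cvg_comp _ (fun x : 'cV[R]_n => x i 0) ul).
exact: coord_continuous.
Qed.

Lemma cvg_dotv (T : Type) (F : set_system T) {FF : Filter F}
    (u v : T -> 'cV[R]_n) (l m : 'cV[R]_n) :
  u t @[t --> F] --> l -> v t @[t --> F] --> m ->
  dotv (u t) (v t) @[t --> F] --> dotv l m.
Proof.
move=> ul vm; apply: cvg_sumr => i.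
by apply: cvgM; exact: cvg_cV_coord.
Qed.

Lemma cvg_enorm (T : Type) (F : set_system T) {FF : Filter F}
    (u : T -> 'cV[R]_n) (l : 'cV[R]_n) :
  u t @[t --> F] --> l -> enorm (u t) @[t --> F] --> enorm l.
Proof.
move=> ul.
have := @continuous_cvg T R R F FF (fun t => dotv (u t) (u t)) Num.sqrt (dotv l l).
apply; first exact: sqrt_continuous.
exact: cvg_dotv.
Qed.

(** Convergence is that of the max norm while the estimates are Euclidean; the bound of a coordinate
    by the Euclidean norm is the bridge. *)
Lemma cvg_enormB (T : Type) (F : set_system T) {FF : Filter F}
    (u : T -> 'cV[R]_n) (l : 'cV[R]_n) :
  enorm (u t - l) @[t --> F] --> 0 -> u t @[t --> F] --> l.
Proof.
move=> ul; apply: cvg_cV => i; apply/cvgrPdist_le => e e0.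
have /cvgrPdist_le/(_ _ e0) := ul; apply: filterS => t.
rewrite sub0r normrN ger0_norm ?enorm_ge0//; apply: le_trans.
rewrite distrC; have := normr_coord_le_enorm (u t - l) i.
by rewrite !mxE.
Qed.

End euclidean_space.

(** An ultrafilter contains each set or its complement, a property inherited through preimages; a
    finer proper filter then has no room for a new set. *)
Lemma ultra_fmap (S T : Type) (f : S -> T) (F : set_system S) :
  UltraFilter F -> UltraFilter (f @ F).
Proof.
move=> FU; split; first exact: fmap_proper_filter.
move=> G GF sFG; apply/seteqP; split => // A GA.
have [//|FnA] := in_ultra_setVsetC (f @^-1` A) FU.
have /sFG GnA : (f @ F) (~` A) by [].
by have /filter_ex[x []] : G (A `&` ~` A) by exact: filterI.
Qed.

(** Stands in for Bolzano-Weierstrass: each coordinate stays in the compact segment [[- K, K]],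
    where an ultrafilter converges. *)
Lemma cvg_ultra_bounded (R : realType) (n : nat) (T : Type) (F : set_system T)
    (u : T -> 'cV[R]_n) (K : R) :
  UltraFilter F -> (\forall t \near F, enorm (u t) <= K) ->
  exists l : 'cV[R]_n, u t @[t --> F] --> l.
Proof.
move=> FU uK.
have FF := @ultra_proper _ F FU.
have /choice[l lP] : forall i : 'I_n, exists l : R, u t i 0 @[t --> F] --> l.
  move=> i; have := @segment_compact R (- K) K; rewrite compact_ultra => cK.
  have [|l [_ /= ?]] := cK _ (ultra_fmap (fun t => u t i 0) FU); last by exists l.
  apply: filterS uK => t /= uK; rewrite in_itv /= -ler_norml.
  exact: le_trans (normr_coord_le_enorm _ _) uK.
exists (\col_i l i); apply: cvg_cV => i; rewrite mxE; exact: lP.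
Qed.

Lemma compact_enorm_ball (R : realType) (n : nat) (K : R) :
  compact [set u : 'cV[R]_n | enorm u <= K].
Proof.
rewrite compact_ultra => F FU FK.
have FF := @ultra_proper _ F FU.
have [l ul] := cvg_ultra_bounded (u := id) FU FK.
exists l; split=> //=.
apply: (ler_cvg (g := fun=> K) (cvg_enorm (u := id) ul)) => //; exact: cvg_cst.
Qed.

(** * Minty's theorem *)

(** Extracts a first-order condition from a variation with quadratic remainder. For positive [a],
    the value [t = a / (2 * (|b| + a))] makes [t * b] at most [a / 2], a contradiction. *)
Lemma le0_of_le_small (R : realType) (a b : R) :
  (forall t, 0 < t -> t <= 1 -> a <= t * b) -> a <= 0.
Proof.
move=> h; rewrite leNgt; apply/negP => a0.
have b0 : 0 < `|b| + a by rewrite ltr_wpDl.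
have t1 : a / (2 * (`|b| + a)) <= 1.
  by rewrite ler_pdivrMr ?mulr_gt0// mul1r; have := normr_ge0 b; lra.
have t0 : 0 < a / (2 * (`|b| + a)) by rewrite divr_gt0// mulr_gt0.
have := h _ t0 t1; rewrite mulrAC ler_pdivlMr ?mulr_gt0// ler_pM2l//.
by have := ler_norm b; lra.
Qed.

Lemma closed_le_fun (R : realType) (T : topologicalType) (f : T -> R) (k : R) :
  continuous f -> closed [set x | f x <= k].
Proof.
by move=> cf; apply: (closed_comp (f := f)) (@closed_le R k) => x _; exact: cf.
Qed.

Section minty.
Variables (R : realType) (n : nat).
Local Notation E := 'cV[R]_n.
Implicit Types (A : operator R n) (x y w : E).

(* The concave function [phi mu] is the minimum over [x] of
   [\sum_k mu_k <x + eta_k, x - xi_k>]; its maximizer over the simplex is the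
   dual solution, and [x0 = \sum_k mu_k (xi_k - eta_k) / 2] the primal one. *)
Lemma monotone_finite_extension m (xi eta : 'I_m -> E) :
  (forall k l, 0 <= dotv (eta k - eta l) (xi k - xi l)) ->
  exists x, forall k, dotv (x + eta k) (x - xi k) <= 0.
Proof.
case: m xi eta => [|m] xi eta mono; first by exists 0 => -[].
pose u k := xi k - eta k; pose p k := dotv (eta k) (xi k).
pose U (mu : 'cV[R]_m.+1) := \sum_k mu k 0 *: u k.
pose P (mu : 'cV[R]_m.+1) := \sum_k mu k 0 * p k.
pose phi mu := - dotv (U mu) (U mu) / 4 - P mu.
pose S := [set mu : 'cV[R]_m.+1 | (forall k, 0 <= mu k 0) /\ \sum_k mu k 0 = 1].
have coordc k : continuous (fun mu : 'cV[R]_m.+1 => mu k 0).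
  by move=> mu; exact: coord_continuous.
have sumc : continuous (fun mu : 'cV[R]_m.+1 => \sum_k mu k 0).
  move=> mu; apply: (cvg_sumr (F := nbhs mu)) => k.
  exact: coordc.
have S0 : S !=set0.
  exists (delta_mx 0 0); split=> [k|]; first by rewrite !mxE ler0n.
  by rewrite (bigD1 0)//= big1 ?mxE ?addr0// => k k0; rewrite mxE (negbTE k0).
have Sco : compact S.
  apply: (@subclosed_compact _ _ [set mu : 'cV[R]_m.+1 | enorm mu <= 1]).
  - rewrite (_ : S = \bigcap_(k in setT) [set mu : 'cV[R]_m.+1 | - mu k 0 <= 0] `&`
        ([set mu : 'cV[R]_m.+1 | \sum_k mu k 0 <= 1] `&`
         [set mu : 'cV[R]_m.+1 | - (\sum_k mu k 0) <= -1])).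
      apply: closedI; first apply: closed_bigI => k _.
        by apply: closed_le_fun => mu; apply: (cvgN (F := nbhs mu)); exact: coordc.
      apply: closedI; first by apply: closed_le_fun; exact: sumc.
      by apply: closed_le_fun => mu; apply: (cvgN (F := nbhs mu)); exact: sumc.
    apply/seteqP; split=> mu /=.
      move=> [mu0 ->]; split=> [k _ /=|]; first by rewrite oppr_le0.
      by rewrite !lexx.
    move=> [mu0 [mu1 mu1']]; split=> [k|]; first by have /= := mu0 k I; rewrite oppr_le0.
    by apply/eqP; rewrite eq_le mu1 -lerN2.
  - exact: compact_enorm_ball.
  - move=> mu [mu0 mu1] /=; rewrite (le_trans (enorm_le_sum _))//.
    by under eq_bigr do rewrite ger0_norm//; rewrite mu1.
have phic : continuous phi.
  move=> mu; rewrite /phi /U /P; apply: (cvgB (F := nbhs mu)).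
    apply: (cvgM (F := nbhs mu)); last exact: cvg_cst.
    apply: (cvgN (F := nbhs mu)); apply: (cvg_dotv (F := nbhs mu)).
      by apply: (cvg_sumr (F := nbhs mu)) => k;
      apply: (cvgZr_tmp (F := nbhs mu)); exact: coordc.
    by apply: (cvg_sumr (F := nbhs mu)) => k;
      apply: (cvgZr_tmp (F := nbhs mu)); exact: coordc.
  apply: (cvg_sumr (F := nbhs mu)) => k.
  by apply: (cvgM (F := nbhs mu)); [exact: coordc|exact: cvg_cst].
have [mu Smu muP] := compact_EVT_max S0 Sco (continuous_subspaceT phic).
have {Smu} [mu0 mu1] : S mu by rewrite inE in Smu.
pose x := 2^-1 *: U mu.
exists x => k.
(* First-order optimality of [mu] towards the vertex [k] of the simplex: [phi v <= phi mu] is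
   expanded and divided by [t], so that the right-hand side is the quadratic remainder. *)
have step t : 0 < t -> t <= 1 ->
    dotv (U mu) (U mu) / 2 - dotv (U mu) (u k) / 2 + P mu - p k
    <= t * ((dotv (U mu) (U mu) - 2 * dotv (U mu) (u k) + dotv (u k) (u k)) / 4).
  move=> t0 t1; pose v := (1 - t) *: mu + t *: delta_mx k 0.
  have Uv : U v = (1 - t) *: U mu + t *: u k.
    rewrite /U scaler_sumr -[t *: u k](_ : \sum_l (t * (l == k)%:R) *: u l = _).
      rewrite -big_split /=; apply: eq_bigr => l _.
      by rewrite /v !mxE andbT [in LHS]scalerDl scalerA.
    rewrite (bigD1 k)//= eqxx mulr1 big1 ?addr0// => l lk.
    by rewrite (negbTE lk) mulr0 scale0r.
  have Pv : P v = (1 - t) * P mu + t * p k.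
    rewrite /P mulr_sumr -[t * p k](_ : \sum_l (t * (l == k)%:R) * p l = _).
      rewrite -big_split /=; apply: eq_bigr => l _.
      by rewrite /v !mxE andbT [in LHS]mulrDl mulrA.
    rewrite (bigD1 k)//= eqxx mulr1 big1 ?addr0// => l lk.
    by rewrite (negbTE lk) mulr0 mul0r.
  have Sv : S v.
    split=> [l|]; first by rewrite /v !mxE addr_ge0 ?mulr_ge0 ?subr_ge0// ?ltW.
    under eq_bigr do rewrite /v !mxE andbT.
    rewrite big_split -!mulr_sumr /= mu1 (bigD1 k)//= eqxx big1 ?addr0 ?mulr1 ?subrK//.
    by move=> l lk; rewrite (negbTE lk).
  have := muP v (mem_set Sv); rewrite /phi Uv Pv.
  move: (U mu) (u k) (P mu) (p k) => a c q s; rewrite !dotvE (dotvC c a) => h.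
  rewrite -(ler_pM2l t0); lra.
have {step} step := le0_of_le_small step.
(* Monotonicity enters here: averaging the pairwise inequalities with weights [mu k 0 * mu l 0]
   gives twice [P mu] minus twice the product of the two barycenters. *)
have PU : dotv (\sum_k mu k 0 *: eta k) (\sum_k mu k 0 *: xi k) <= P mu.
  set a := \sum_k mu k 0 *: eta k; set c := \sum_k mu k 0 *: xi k.
  have : 0 <= \sum_k \sum_l mu k 0 * mu l 0 * dotv (eta k - eta l) (xi k - xi l).
    by apply: sumr_ge0 => i _; apply: sumr_ge0 => j _; rewrite !mulr_ge0.
  have -> : \sum_k \sum_l mu k 0 * mu l 0 * dotv (eta k - eta l) (xi k - xi l) =
      \sum_k mu k 0 * (p k + P mu - dotv (eta k) c - dotv a (xi k)).
    apply: eq_bigr => i _.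
    transitivity (mu i 0 * (\sum_l (mu l 0 * p i + mu l 0 * p l -
        mu l 0 * dotv (eta i) (xi l) - mu l 0 * dotv (eta l) (xi i)))).
      by rewrite mulr_sumr; apply: eq_bigr => j _; rewrite !dotvE /p; ring.
    rewrite !sumrB big_split /= -mulr_suml mu1 mul1r.
    congr (_ * (_ - _ - _)); first rewrite dotvC dotv_suml.
      by apply: eq_bigr => l _; rewrite dotvZl dotvC.
    by rewrite dotv_suml; apply: eq_bigr => l _; rewrite dotvZl.
  rewrite (_ : \sum_k _ = 2 * P mu - 2 * dotv a c); first lra.
  transitivity (\sum_k (mu k 0 * p k + mu k 0 * P mu - mu k 0 * dotv (eta k) c
      - mu k 0 * dotv a (xi k))).
    by apply: eq_bigr => l _; ring.
  rewrite !sumrB big_split /= -mulr_suml mu1 mul1r.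
  rewrite (_ : \sum_i mu i 0 * dotv (eta i) c = dotv a c); last first.
    by rewrite dotv_suml; apply: eq_bigr => l _; rewrite dotvZl.
  rewrite (_ : \sum_i mu i 0 * dotv a (xi i) = dotv a c); last first.
    by rewrite dotvC dotv_suml; apply: eq_bigr => l _; rewrite dotvZl dotvC.
  by rewrite -/(P mu); ring.
have Uac : U mu = \sum_k mu k 0 *: xi k - \sum_k mu k 0 *: eta k.
  by rewrite -sumrB; apply: eq_bigr => l _; rewrite scalerBr.
(* The optimality condition bounds the target by [phi mu], and this inequality says [phi mu <= 0].
   It follows from [PU] because the sum of the two barycenters has a nonnegative square. *)
have PB : - dotv (U mu) (U mu) / 4 <= P mu.
  have := dotv_ge0 (\sum_k mu k 0 *: xi k + \sum_k mu k 0 *: eta k).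
  rewrite Uac; move: PU; move: (\sum_k mu k 0 *: xi k) (\sum_k mu k 0 *: eta k).
  move=> c a; rewrite !dotvE (dotvC c a); lra.
rewrite (_ : dotv (x + eta k) (x - xi k) =
    dotv (U mu) (U mu) / 4 - dotv (U mu) (u k) / 2 - p k); first lra.
by rewrite /x /u /p !dotvE (dotvC (eta k) (U mu)); field.
Qed.

(** The graph of [A] with the single pair [(x, y)] added is still monotone, so by maximality it
    already contains the pair. *)
Lemma maximal_monotoneP A x y : maximal_monotone A ->
  (forall xi eta, A xi eta -> 0 <= dotv (y - eta) (x - xi)) -> A x y.
Proof.
move=> [mA maxA] h.
apply: (maxA (fun xi => A xi `|` [set eta | xi = x /\ eta = y])).
- move=> x1 y1 x2 y2 /= [A1|[-> ->]] [A2|[-> ->]].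
  + exact: mA.
  + by rewrite -opprB dotvNl -dotvNr opprB; exact: h.
  + exact: h.
  + by rewrite subrr dotv0l.
- by move=> xi eta; left.
- by right.
Qed.

Lemma maximal_monotone_neq0 A : maximal_monotone A -> exists x y, A x y.
Proof.
move=> Amax; apply: contrapT => A0; apply: (A0); exists 0, 0.
apply: maximal_monotoneP => // xi eta Axe.
by exfalso; apply: A0; exists xi, eta.
Qed.

Lemma dotv_continuous_shift (a b : E) :
  continuous (fun x : E => dotv (x + a) (x - b)).
Proof.
move=> x; apply: (cvg_dotv (F := nbhs x)); first by apply: cvgD; [exact: cvg_id|exact: cvg_cst].
by apply: cvgB; [exact: cvg_id|exact: cvg_cst].
Qed.

(** The condition places [x] in the ball with diameter from [- a] to [b]. Only some bound is wanted,
    to confine the constraints of Minty's theorem to a compact set; the factor 2 is not sharp. *)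
Lemma enorm_le_dotv_shift x a b :
  dotv (x + a) (x - b) <= 0 -> enorm x <= 2 * (enorm a + enorm b).
Proof.
rewrite !dotvE -sqr_enorm => h.
have := dotv_le_enorm x b; have := dotv_le_enorm a b.
have := normr_dotv a x; rewrite ler_norml => /andP[h1 _] h2 h3.
have := enorm_ge0 a; have := enorm_ge0 b; have := enorm_ge0 x.
move: (enorm a) (enorm b) (enorm x) h h1 h2 h3 => p q y h h1 h2 h3 y0 q0 p0.
rewrite leNgt; apply/negP => hy.
have d0 : 0 < y - 2 * (p + q) by rewrite subr_gt0.
have := mulr_gt0 d0 d0; have := mulr_ge0 (ltW d0) (addr_ge0 p0 q0).
nra.
Qed.

(** Maximality reduces the resolvent equation to one inequality on [x] for each pair of the graph.
    After scaling by [delta], finitely many of them are solved by [monotone_finite_extension], and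
    compactness solves all at once. *)
Theorem minty A (delta : R) w : maximal_monotone A -> 0 < delta ->
  exists x y, A x y /\ x + delta *: y = w.
Proof.
move=> Amax d0.
suff [x xP] : exists x, forall xi eta, A xi eta ->
    dotv (x + (delta *: eta - w)) (x - xi) <= 0.
  exists x, (delta^-1 *: (w - x)).
  split; last by rewrite scalerA divff ?gt_eqF// scale1r addrC subrK.
  apply: maximal_monotoneP => // xi eta Axe.
  rewrite -(pmulr_rge0 _ d0) -dotvZl scalerBr scalerA divff ?gt_eqF// scale1r.
  rewrite -oppr_le0 -dotvNl (le_trans _ (xP _ _ Axe))// le_eqVlt; apply/orP; left.
  by apply/eqP; congr dotv; rewrite !opprB addrCA.
have [xi0 [eta0 A0]] := maximal_monotone_neq0 Amax.
pose a0 := delta *: eta0 - w; pose s := enorm a0 + enorm xi0.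
pose g (q : E * E) := [set x | dotv (x + (delta *: q.2 - w)) (x - q.1) <= 0].
pose B := [set x : E | enorm x <= 2 * s].
have gB x : g (xi0, eta0) x -> B x.
  by move=> /enorm_le_dotv_shift.
have := @compact_enorm_ball R n (2 * s); rewrite compact_In0.
move=> /(_ (E * E)%type [set q | A q.1 q.2] (fun q => B `&` g q)) [].
- exists g => // q _; apply: closed_le_fun; exact: dotv_continuous_shift.
- move=> D' D'A.
  (* One reference pair joins every finite family, so that the solution falls in the fixed ball
     [B]. *)
  pose l := (xi0, eta0) :: finmap.enum_fset D'.
  have lA q : q \in l -> A q.1 q.2.
    by rewrite inE => /predU1P[->//|/D'A]; rewrite inE.
  have [|x xP] := @monotone_finite_extension (size l)
      (fun k => (nth (xi0, eta0) l k).1)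
      (fun k => delta *: (nth (xi0, eta0) l k).2 - w).
    move=> k k'; rewrite opprB subrKA -scalerBr dotvZl mulr_ge0 ?(ltW d0)//.
    by have [mA _] := Amax; apply: mA; apply: lA; rewrite mem_nth.
  have xl q : q \in l -> g q x.
    by move=> ql; have := xP (Ordinal (etrans (index_mem q l) ql)); rewrite /= nth_index.
  exists x => q /= qD; split; first by apply: gB; apply: xl; rewrite mem_head.
  by apply: xl; rewrite inE qD orbT.
- by move=> x xP; exists x => xi eta Axe; have [] := xP (xi, eta) Axe.
Qed.

(** By maximality [A x] is an intersection of closed half-spaces, one for each pair of the graph. *)
Lemma maximal_monotone_closed A x : maximal_monotone A -> closed (A x).
Proof.
move=> Amax.
rewrite (_ : A x = \bigcap_(q in [set q : E * E | A q.1 q.2])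
    [set y | dotv (q.2 - y) (x - q.1) <= 0]).
  apply: closed_bigI => q _; apply: closed_le_fun => y.
  apply: (cvg_dotv (F := nbhs y)); last exact: cvg_cst.
  by apply: cvgB; [exact: cvg_cst|exact: cvg_id].
apply/seteqP; split=> y.
  move=> Axy q /= Aq; rewrite -oppr_ge0 -dotvNl opprB.
  by have [mA _] := Amax; exact: mA.
move=> h; apply: maximal_monotoneP => // xi eta Axe.
by have /= := h (xi, eta) Axe; rewrite -oppr_ge0 -dotvNl opprB.
Qed.

(** Excludes the default value of [metric_proj]: a nearest point exists, by minimizing the norm over
    the part of [A x] inside a ball that meets it. *)
Lemma minimal_section_mem A x : maximal_monotone A -> domain A x ->
  A x (minimal_section A x).
Proof.
move=> Amax [q Aq].
have enormc : continuous (@enorm R n).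
  by move=> y; exact: (cvg_enorm (F := nbhs y) (u := id)).
pose S := A x `&` [set y | enorm y <= enorm q].
have Sco : compact S.
  apply: (@subclosed_compact _ _ [set y : E | enorm y <= enorm q]).
  - apply: closedI; first exact: maximal_monotone_closed.
    exact: closed_le_fun.
  - exact: compact_enorm_ball.
  - by move=> y [].
have S0 : S !=set0 by exists q; split => /=.
have [y Sy yP] := compact_EVT_min S0 Sco (continuous_subspaceT enormc).
rewrite inE in Sy; case: Sy => Ay yq.
rewrite /minimal_section /metric_proj.
have : exists p, A x p /\ forall q, A x q -> enorm (0 - p) <= enorm (0 - q).
  exists y; split=> // q' Aq'; rewrite !sub0r !enormN.
  have [q'q|/ltW qq'] := leP (enorm q') (enorm q); last exact: le_trans yq qq'.
  by apply: yP; rewrite inE.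
by move=> /(xgetPex 0)[].
Qed.

End minty.

(** * Differentiation with respect to nu *)

Section interval_measures.
Variable R : realType.
Local Notation RR := (measurableTypeR R).

(** Restricting both measures to []0, T]] makes the uniqueness theorem on half-open intervals of the
    line applicable: such an interval cut by []0, T]] is again half-open, or empty. *)
Lemma oc_measure_unique (T : R) (m1 m2 : {measure set RR -> \bar R}) :
  (m1 (`]0%R, T]%classic : set RR) < +oo)%E ->
  (forall s t, 0 <= s -> s <= t -> t <= T -> m1 `]s, t]%classic = m2 `]s, t]%classic) ->
  forall A : set RR, measurable A -> A `<=` `]0, T]%classic -> m1 A = m2 A.
Proof.
move=> m1oo m12 A mA AT.
have mT : measurable (`]0, T]%classic : set RR) by exact: measurable_itv.
rewrite -(setIidl AT).
suff : forall B : set RR, measurable B -> mrestr m1 mT B = mrestr m2 mT B by apply.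
move=> B mB.
apply: (@measure_unique _ R RR (@ocitv R) (fun k : nat => `](- k%:R), k%:R]%classic)) => //.
- by move=> C D oC oD; exact: (@measurableI _ (ocitv_type R)).
- by move=> k; exact: is_ocitv.
- rewrite -subTset => /= x _ /=.
  exists (Num.bound `|x|) => //=; rewrite in_itv /=.
  by have := archi_boundP (normr_ge0 x); rewrite ltr_norml => /andP[-> /ltW].
- move=> _ [[s t] _ <-] /=; rewrite /mrestr.
  have -> : `]s, t]%classic `&` `]0, T]%classic =
      `]Num.max s 0, Num.min t T]%classic :> set R.
    apply/seteqP; split=> x /=; rewrite !in_itv /= gt_max le_min.
      by move=> [/andP[-> ->] /andP[-> ->]].
    by move=> /andP[/andP[-> ->] /andP[-> ->]].
  have [st|st] := leP (Num.max s 0) (Num.min t T); last first.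
    by rewrite set_itv_ge ?bnd_simp ?measure0// -leNgt ltW.
  by apply: m12 => //; [rewrite le_max lexx orbT|rewrite ge_min lexx orbT].
- move=> k; apply: le_lt_trans m1oo; rewrite /mrestr.
  by apply: le_measure; rewrite ?inE//; apply: measurableI => //; exact: measurable_itv.
Qed.

End interval_measures.

(** * Densities of functions that are Lipschitz with respect to [t + r t] *)

Section nu_measure.
Variables (R : realType) (T : R) (T0 : 0 < T) (r : R -> R).
Hypothesis rc : {within `[0, T], continuous r}.
Hypothesis rnd : {in `[0, T] &, nondecreasing_fun r}.
Local Notation RR := (measurableTypeR R).
Local Notation N := (nu T0 rc rnd).

Lemma nu_itv s t : 0 <= s -> s <= t -> t <= T ->
  N `]s, t]%classic = ((t + r t) - (s + r s))%:E.
Proof.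
move=> s0 st tT; rewrite /nu measure_addE /lambda /dr /= /mfrestr /mrestr.
have -> : `]s, t]%classic `&` `[0, T]%classic = `]s, t]%classic :> set R.
  apply: setIidl => x /=; rewrite !in_itv /= => /andP[sx xt].
  by rewrite (le_trans s0 (ltW sx)) (le_trans xt).
rewrite stieltjes_itv// lebesgue_measure_itv /= lte_fin.
case: ltgtP st => [st _|//|-> _]; first by rewrite -EFinB -EFinD; congr EFin; ring.
by rewrite add0e subrr; congr EFin; ring.
Qed.

(** The extension of [r] is constant to the left of 0, so its Stieltjes measure has no atom at 0, a
    point that the intervals []s, t]] of [[0, T]] never contain. *)
Lemma stieltjes_neg_itv : stieltjes T0 rc rnd `](-1)%R, 0%R]%classic = 0%E.
Proof.
rewrite /stieltjes /= /lebesgue_stieltjes_measure /measure_extension.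
rewrite measurable_mu_extE /=; last exact: is_ocitv.
rewrite wlength_itv_bnd ?lerN10// /extend /= /clamp.
rewrite (min_l (ltW T0)) (_ : Num.min (-1) T = -1).
  by rewrite maxxx (max_l (lerN10 R)) subrr.
by rewrite min_l// (le_trans (lerN10 R))// ltW.
Qed.

Lemma nu_set0 : N [set 0] = 0%E.
Proof.
rewrite /nu measure_addE /lambda /dr /= /mfrestr /mrestr.
have -> : [set 0 : R] `&` `[0, T]%classic = [set 0].
  by apply: setIidl => x /= ->; rewrite in_itv /= lexx ltW.
rewrite lebesgue_measure_set1 add0e; apply/eqP; rewrite eq_le measure_ge0 andbT.
rewrite -stieltjes_neg_itv; apply: le_measure; rewrite ?inE//.
by move=> x /= ->; rewrite in_itv /= lexx ltrN10.
Qed.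

(** Continuity of [r] excludes an atom at [T]. The endpoint has to be discarded because no
    derivative from the right is available there. *)
Lemma nu_setT : N [set T] = 0%E.
Proof.
have mT : measurable ([set T] : set RR) by [].
apply/eqP; rewrite eq_le measure_ge0 andbT.
apply/lee_addgt0Pr => e e0; rewrite add0e.
have /subspace_continuousP/(_ T) := rc.
have TT : `[0, T]%classic T by rewrite /= in_itv /= ltW// lexx.
have e20 : 0 < e / 2 by rewrite divr_gt0.
move=> /(_ TT) /cvgrPdist_le/(_ (e / 2) e20).
move=> /nbhs_ballP[d /= d0 dP].
(* Close enough to [T] for the time part and the [r] part of [N ]s, T]] to be at most [e / 2] each,
   and clipped at 0 to stay in [[0, T]]. *)
pose s := Num.max (T - e / 2) (Num.max 0 (T - d / 2)).
have sT : s < T by rewrite !gt_max T0 !gtrBl !divr_gt0.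
have s0 : 0 <= s by rewrite !le_max lexx /= orbT.
have sd : T - d / 2 <= s by rewrite !le_max lexx /= !orbT.
have se : T - e / 2 <= s by rewrite !le_max lexx.
have h : `|r T - r s| <= e / 2.
  apply: dP; last by rewrite /= in_itv /= s0 ltW.
  by rewrite /ball /= ger0_norm ?subr_ge0 ?ltW//; lra.
apply: (@le_trans _ _ (N `]s, T]%classic)).
  apply: le_measure; rewrite ?inE//.
  by move=> x /= ->; rewrite in_itv /= sT lexx.
rewrite nu_itv ?(ltW sT)// lee_fin.
by have := ler_norm (r T - r s); lra.
Qed.

(* [y + K v] and [K v - y] are nondecreasing, with [v t = t + r t]; the sum of
   their Stieltjes measures is [2 K nu], so both are dominated by [nu]. *)
Lemma nu_lipschitz_density (y : R -> R) (K : R) : 0 <= K ->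
  {within `[0, T], continuous y} ->
  (forall s t, 0 <= s -> s <= t -> t <= T ->
     `|y t - y s| <= K * ((t + r t) - (s + r s))) ->
  exists2 g : R -> R, N.-integrable `[0, T] (EFin \o g) &
    forall s t, 0 <= s -> s <= t -> t <= T ->
      \int[N]_(x in `]s, t]) g x = y t - y s.
Proof.
move=> K0 yc ylip.
pose v t := t + r t.
have vc : {within `[0, T], continuous v}.
  have idc : {within `[0, T], continuous (fun t : R => t)}.
    by apply: continuous_subspaceT => x; exact: cvg_id.
  by move=> x; apply: cvgD; [exact: idc|exact: rc].
pose f1 t := K * v t + y t; pose f2 t := K * v t - y t.
have f1c : {within `[0, T], continuous f1}.
  by move=> x; apply: cvgD; [apply: cvgM; [exact: cvg_cst|exact: vc]|exact: yc].
have f2c : {within `[0, T], continuous f2}.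
  by move=> x; apply: cvgB; [apply: cvgM; [exact: cvg_cst|exact: vc]|exact: yc].
have f1nd : {in `[0, T] &, nondecreasing_fun f1}.
  move=> s t; rewrite !in_itv /= => /andP[s0 sT] /andP[t0 tT] st.
  by have := ylip _ _ s0 st tT; rewrite /f1 /v ler_norml; lra.
have f2nd : {in `[0, T] &, nondecreasing_fun f2}.
  move=> s t; rewrite !in_itv /= => /andP[s0 sT] /andP[t0 tT] st.
  by have := ylip _ _ s0 st tT; rewrite /f2 /v ler_norml; lra.
pose m1 := stieltjes T0 f1c f1nd; pose m2 := stieltjes T0 f2c f2nd.
have m2K0 : 0 <= 2 * K by rewrite mulr_ge0.
pose c := NngNum m2K0.
have m12 : forall A : set RR, measurable A -> A `<=` `]0, T]%classic ->
    measure_add m1 m2 A = mscale c N A.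
  apply: oc_measure_unique => [|s t s0 st tT].
    rewrite -[X in (X < _)%E]/(measure_add m1 m2 _) measure_addE.
    by rewrite !stieltjes_itv ?(ltW T0)// -EFinD ltry.
  rewrite -[LHS]/(measure_add m1 m2 _) measure_addE !stieltjes_itv//.
  rewrite -[RHS]/((2 * K)%:E * N `]s, t]%classic)%E nu_itv// -EFinD -EFinM.
  by congr EFin; rewrite /f1 /f2 /v; ring.
have mT : measurable (`]0, T]%classic : set RR) by exact: measurable_itv.
have m1oo : (m1 `]0%R, T]%classic < +oo)%E by rewrite stieltjes_itv ?(ltW T0)// ltry.
pose D1 := mfrestr mT m1oo.
have D1N : charge_of_finite_measure D1 `<< N.
  apply/null_content_dominatesP => A mA NA.
  rewrite /= /D1 /mfrestr /mrestr; apply/eqP; rewrite eq_le measure_ge0 andbT.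
  have mAT : measurable (A `&` `]0, T]%classic) by exact: measurableI.
  apply: (@le_trans _ _ (measure_add m1 m2 (A `&` `]0, T]%classic))).
    by rewrite measure_addE leeDl.
  rewrite (m12 _ mAT)//.
  apply: (@le_trans _ _ ((2 * K)%:E * N A)%E); last by rewrite NA mule0.
  by rewrite lee_wpmul2l ?lee_fin// le_measure ?inE.
pose h := Radon_Nikodym (charge_of_finite_measure D1) N.
have hint : N.-integrable setT h := Radon_Nikodym_integrable D1N.
have hfin x : h x \is a fin_num := Radon_Nikodym_fin_num x D1N.
(* [h] is the density of [K v + y]; subtracting that of [K v] leaves that of [y]. *)
pose g t := fine (h t) - K.
have gE : EFin \o g = (h \- cst K%:E)%E.
  by apply/funext => x; rewrite /g /= EFinB fineK.
have cint (D : set RR) : measurable D -> N.-integrable D (cst K%:E).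
  by move=> mD; apply: finite_measure_integrable_cst.
exists g.
  rewrite gE; apply: integrableB; first exact: measurable_itv.
    exact: (integrableS measurableT).
  by apply: cint; exact: measurable_itv.
move=> s t s0 st tT.
have mt : measurable (`]s, t]%classic : set RR) by exact: measurable_itv.
rewrite /Rintegral; under eq_integral do rewrite -/((EFin \o g) _) gE.
rewrite integralB//; [|exact: (integrableS measurableT)|exact: cint].
rewrite -Radon_Nikodym_integral// integral_cst//.
rewrite -[X in (_ * X)%E]/(N `]s, t]%classic) nu_itv//.
rewrite /= /D1 /mfrestr /mrestr.
have -> : `]s, t]%classic `&` `]0, T]%classic = `]s, t]%classic :> set R.
  apply: setIidl => x /=; rewrite !in_itv /= => /andP[sx xt].
  by rewrite (le_lt_trans s0 sx) (le_trans xt).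
by rewrite stieltjes_itv//= /f1 /v; ring.
Qed.

End nu_measure.

(** * Lebesgue differentiation through the change of time *)

Section nu_differentiation.
Variables (R : realType) (T : R) (T0 : 0 < T) (r : R -> R).
Hypothesis rc : {within `[0, T], continuous r}.
Hypothesis rnd : {in `[0, T] &, nondecreasing_fun r}.
Local Notation RR := (measurableTypeR R).
Local Notation N := (nu T0 rc rnd).
Local Notation leb := (@lebesgue_measure R).

(** [r] is clamped outside [[0, T]] but the linear term is not: this gives an increasing bijection
    of the whole line, with an inverse defined everywhere. *)
Definition clock (t : R) := t + r (clamp T t).

Lemma clockE t : t \in `[0, T] -> clock t = t + r t.
Proof. by move=> tT; rewrite /clock clampE. Qed.

Lemma clock_lt s t : s < t -> clock s < clock t.
Proof.
move=> st; rewrite /clock ltr_leD// rnd ?clamp_itv//.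
by rewrite /clamp le_max2// le_min2// ltW.
Qed.

Lemma clock_continuous : continuous clock.
Proof.
move=> x; apply: (cvgD (F := nbhs x)); first exact: cvg_id.
have /subspace_continuousP/(_ _ (clamp_itv T0 x)) rx := rc.
apply: (cvg_trans _ rx); move=> P /= wP.
have {}wP : nbhs (clamp T x) [set y | y \in `[0, T] -> P (r y)] := wP.
have := @clamp_continuous _ T x _ wP.
by apply: (@filterS _ (nbhs x)) => y /(_ (clamp_itv T0 y)).
Qed.

(** The clamped [r] stays between [r 0] and [r T], so the value [s] is crossed between [s - r T] and
    [s - r 0]. *)
Lemma clock_surj s : exists t, clock t = s.
Proof.
have r0T : r 0 <= r T by apply: rnd; rewrite ?in_itv/= ?lexx ltW.
have clampr x : r 0 <= r (clamp T x) <= r T.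
  have := clamp_itv T0 x; rewrite in_itv /= => /andP[x0 xT].
  by apply/andP; split; apply: rnd; rewrite ?in_itv/= ?lexx ?x0 ?xT// ltW.
have ab : s - r T <= s - r 0 by rewrite lerD2l lerN2.
have clockc : {within `[s - r T, s - r 0], continuous clock}.
  by apply: continuous_subspaceT => x; exact: clock_continuous.
have [|t _ <-] := IVT ab clockc (v := s); last by exists t.
have /andP[_ h1] := clampr (s - r T); have /andP[h2 _] := clampr (s - r 0).
by rewrite /clock ge_min le_max; apply/andP; split; apply/orP; [left|right]; lra.
Qed.

(* Under the inverse of [clock], Lebesgue measure is carried to [nu], so
   [clock]-derivatives of [nu]-integrals become ordinary derivatives. *)
Lemma nu_differentiation (g : R -> R) :
  N.-integrable `[0, T] (EFin \o g) ->
  {ae N, forall t, t \in `[0, T[ ->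
    ((t' + r t') - (t + r t))^-1 * \int[N]_(s in `]t, t']) g s @[t' --> t^'+]
      --> g t}.
Proof.
move=> gint.
have /choice[sg sgK] := clock_surj.
(* These two equivalences turn the preimage of []s, t]] under the inverse clock [sg] into []clock s,
   clock t]]. *)
have lt_sg a s : (a < sg s) = (clock a < s).
  apply/idP/idP => [/clock_lt|]; first by rewrite sgK.
  by apply: contraTT; rewrite -!leNgt -{2}(sgK s) le_eqVlt =>
    /predU1P[->//|/clock_lt/ltW].
have le_sg a s : (sg s <= a) = (s <= clock a).
  by rewrite !leNgt lt_sg.
have msg : measurable_fun setT (sg : RR -> RR).
  apply: nondecreasing_measurable => // x y xy.
  by rewrite le_sg sgK.
pose sgm : {mfun RR >-> RR} := HB.pack sg (isMeasurableFun.Build _ _ _ _ _ msg).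
pose P := pushforward leb sgm.
have mT : measurable (`]0, T]%classic : set RR) by exact: measurable_itv.
have NP (A : set RR) : measurable A -> A `<=` `]0, T]%classic -> N A = P A.
  apply: oc_measure_unique => [|s t s0 st tT].
    by rewrite -[X in (X < _)%E]/(N `]0%R, T]%classic) nu_itv ?ltry// ltW.
  rewrite -[LHS]/(N `]s, t]%classic) nu_itv//.
  rewrite -[RHS]/(leb (sg @^-1` `]s, t]%classic)).
  rewrite (_ : _ @^-1` _ = `]clock s, clock t]%classic); last first.
    by apply/seteqP; split=> x; rewrite /= !in_itv /= lt_sg le_sg.
  rewrite lebesgue_measure_itv /= lte_fin !clockE; last 2 first.
  - by rewrite in_itv /=; apply/andP; split; lra.
  - by rewrite in_itv /=; apply/andP; split; lra.
  case: ltP => [_|h]; first by rewrite -EFinB.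
  have rst : r s <= r t.
    by apply: rnd => //; rewrite in_itv /=; apply/andP; split; lra.
  by congr EFin; lra.
have gint' : N.-integrable `]0, T] (EFin \o g).
  by apply: integrableS gint => //; apply: subset_itvr; rewrite bnd_simp.
(* Cut off outside []0, T]], where [N] and the image [P] of Lebesgue measure agree, so that [f] is
   integrable on the line and has a primitive from minus infinity. *)
pose G := g \_ (`]0, T]%classic : set R).
have mg : measurable_fun (`]0, T]%classic : set RR) g.
  by move/integrableP : gint' => [/measurable_EFinP].
have mG : measurable_fun [set: RR] G by apply/(measurable_restrictT g mT).
pose f := G \o sg.
have mf : measurable_fun [set: RR] f by exact: measurableT_comp.
have fint : leb.-integrable setT (EFin \o f).
  apply/integrableP; split; first exact/measurable_EFinP.
  have mEG : measurable_fun [set: RR] (fun y => `|(G y)%:E|)%E.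
    by apply: measurableT_comp => //; exact/measurable_EFinP.
  have <- : (\int[P]_y `|(G y)%:E| = \int[leb]_x `|(EFin \o f) x|)%E.
    by rewrite ge0_integral_pushforward.
  rewrite (_ : (fun y => _) = (fun y => `|(g y)%:E|%E) \_ `]0, T]); last first.
    by apply/funext => y; rewrite /G /patch; case: ifP => // _; rewrite abse0.
  rewrite -integral_mkcond (eq_measure_integral N); last first.
    by move=> A mA AT; exact/esym/NP.
  by have /integrableP[] := gint'.
have flocal := open_integrable_locally openT fint.
have fintS (A : set RR) : measurable A -> leb.-integrable A (EFin \o f).
  by move=> mA; exact: integrableS fint.
have := FTC1Ny (fun y => fintS _ (measurable_itv _)) flocal.
move=> /= [B [mB B0 badB]].
pose F x := (\int[leb]_(s in `]-oo, x]) f s)%R.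
have FE s t : 0 <= s -> s <= t -> t <= T ->
    F (clock t) - F (clock s) = (\int[N]_(x in `]s, t]) g x)%R.
  move=> s0 st tT.
  rewrite Rintegral_itvB//; [|exact: fintS|rewrite bnd_simp]; last first.
    by case: ltgtP st => // [/clock_lt/ltW//|-> _].
  have -> : `]clock s, clock t]%classic = sgm @^-1` `]s, t]%classic.
    by apply/seteqP; split=> x; rewrite /= !in_itv /= lt_sg le_sg.
  have mst : measurable (`]s, t]%classic : set RR) by exact: measurable_itv.
  rewrite /Rintegral -(integral_pushforward msg (f := EFin \o G))//; last 2 first.
  - exact/measurable_EFinP.
  - by apply: fintS; rewrite -[X in measurable X]setTI; exact: (msg measurableT _ mst).
  congr fine; rewrite [LHS](eq_measure_integral N); last first.
    move=> A mA Ast; apply: (etrans _ (esym (NP A mA _))) => // x /Ast.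
    rewrite /= !in_itv /= => /andP[sx xt].
    by rewrite (le_lt_trans s0 sx) (le_trans xt).
  apply: eq_integral => x; rewrite inE /= in_itv /= => /andP[sx xt].
  by rewrite /G patchE mem_set// /= in_itv /= (le_lt_trans s0 sx) (le_trans xt).
have mclock : measurable_fun setT (clock : RR -> RR).
  apply: nondecreasing_measurable => // x y.
  by rewrite le_eqVlt => /predU1P[->//|/clock_lt/ltW].
have main (t : R) : 0 < t -> t < T -> derivable F (clock t) 1 ->
    derive1 F (clock t) = f (clock t) ->
    ((t' + r t') - (t + r t))^-1 * \int[N]_(s in `]t, t']) g s @[t' --> t^'+]
      --> g t.
  move=> tpos tltT dF dFE.
  have tT' : t \in `[0, T] by rewrite in_itv /= !ltW.
  have sgt : sg (clock t) = t.
    apply/eqP; rewrite eq_le le_sg lexx /= leNgt.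
    by apply/negP => /clock_lt; rewrite sgK ltxx.
  have fE : f (clock t) = g t.
    by rewrite /f /= sgt /G patchE mem_set//= in_itv /= tpos ltW.
  rewrite -fE -dFE.
  (* The filter [0^'] excludes the increment 0; strict monotonicity of the clock guarantees this. *)
  have hcvg : clock t' - clock t @[t' --> t^'+] --> 0^'.
    move=> A A0.
    have : nbhs t (fun t' => clock t' - clock t != 0 -> A (clock t' - clock t)).
      have c0 : clock t' - clock t @[t' --> t] --> 0.
        rewrite -[X in _ --> X](subrr (clock t)).
        apply: (cvgB (F := nbhs t)); [exact: clock_continuous|exact: cvg_cst].
      exact: (c0 _ A0).
    apply: (@filterS _ (nbhs t)) => t' h tt'.
    by apply: h; rewrite subr_eq0 gt_eqF// clock_lt.
  have Fd : h^-1 *: (F (h + clock t) - F (clock t)) @[h --> 0^'] --> derive1 F (clock t).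
    rewrite derive1E; move: dF; rewrite /derivable => dF.
    apply: cvg_trans dF; apply: near_eq_cvg; near=> h.
    by rewrite /= [h *: 1]mulr1.
  apply: cvg_trans (cvg_comp _ _ hcvg Fd); apply: near_eq_cvg.
  near=> t'.
  have tt' : t < t' by near: t'; exact: nbhs_right_gt.
  have t'T : t' < T by near: t'; exact: nbhs_right_lt.
  have t't' : t' \in `[0, T] by rewrite in_itv /=; apply/andP; split; lra.
  by rewrite /comp -!clockE// -FE ?(ltW tt') ?(ltW t'T) ?(ltW tpos)// subrK.
(* The bad times are those whose clock value is bad for Lebesgue measure. The point 0 is added
   because [N] is compared with the image measure only on []0, T]]. *)
exists ((clock @^-1` B `&` `]0, T]%classic) `|` [set 0]); split.
- apply: measurableU => //; apply: measurableI => //.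
  by rewrite -[X in measurable X]setTI; exact: mclock.
- apply/eqP; rewrite eq_le measure_ge0 andbT.
  have mB' : measurable (clock @^-1` B `&` `]0, T]%classic : set RR).
    by apply: measurableI => //; rewrite -[X in measurable X]setTI; exact: mclock.
  apply: (@le_trans _ _ (N (clock @^-1` B `&` `]0%R, T]%classic) + N [set 0%R])%E).
    exact: measureU2.
  rewrite [X in (_ + X)%E]nu_set0 adde0 NP//.
  apply: (@le_trans _ _ (leb B)); last by rewrite B0.
  apply: (@le_measure _ _ _ leb); rewrite ?inE//.
    by rewrite -[X in measurable X]setTI; exact: (msg measurableT _ mB').
  by move=> x [] /=; rewrite sgK.
- move=> t /= tbad; apply: contrapT => /not_orP[tB t0].
  apply: tbad => tT; move: (tT); rewrite in_itv /= => /andP[t0' tltT].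
  have tpos : 0 < t by rewrite lt_neqAle t0' eq_sym andbT; apply/eqP.
  have [dF dFE] : derivable F (clock t) 1 /\ derive1 F (clock t) = f (clock t).
    apply: contrapT => h; apply: tB; split; first by apply: badB.
    by rewrite /= in_itv /= tpos ltW.
  exact: main.
Unshelve. all: by end_near. Qed.

Lemma dlambda_dnuE :
  EFin \o dlambda_dnu T0 rc rnd =
  Radon_Nikodym (charge_of_finite_measure (lambda T)) N.
Proof.
apply/funext => t /=; rewrite /dlambda_dnu fineK//.
exact: (Radon_Nikodym_fin_num _ (@lambda_dominated _ _ T0 _ rc rnd)).
Qed.

Lemma dlambda_dnu_integrable : N.-integrable `[0, T] (EFin \o dlambda_dnu T0 rc rnd).
Proof.
rewrite dlambda_dnuE; apply: (integrableS measurableT) => //.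
exact: (Radon_Nikodym_integrable (@lambda_dominated _ _ T0 _ rc rnd)).
Qed.

Lemma integral_dlambda_dnu s t : 0 <= s -> s <= t -> t <= T ->
  \int[N]_(x in `]s, t]) dlambda_dnu T0 rc rnd x = t - s.
Proof.
move=> s0 st tT; rewrite /Rintegral.
rewrite (eq_integral (Radon_Nikodym (charge_of_finite_measure (lambda T)) N));
  last by move=> x _; rewrite -dlambda_dnuE.
rewrite -(Radon_Nikodym_integral (@lambda_dominated _ _ T0 _ rc rnd)); last first.
  exact: measurable_itv.
rewrite /= /lambda /mfrestr /mrestr.
have -> : `]s, t]%classic `&` `[0, T]%classic = `]s, t]%classic :> set R.
  apply: setIidl => x /=; rewrite !in_itv /= => /andP[sx xt].
  by rewrite (le_trans s0 (ltW sx)) (le_trans xt).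
rewrite lebesgue_measure_itv /= lte_fin; case: ltP => // ts.
by have /eqP -> : s == t; [rewrite eq_le st ts|rewrite subrr].
Qed.

End nu_differentiation.

(** * A continuous modulus for the driving path *)

Section variation_clock.
Variable R : realType.

(** [w] is the sum of the total variations of the coordinates, each continuous because the
    coordinate is. It does for [z] and [J] what [t + r t] does for [Y]. *)
Lemma BVC_clock d (T : R) (z : R -> 'cV[R]_d) : 0 < T -> BVC 0 T z ->
  exists2 w : R -> R, {within `[0, T], continuous w} &
    forall s t, 0 <= s -> s <= t -> t <= T -> enorm (z t - z s) <= w t - w s.
Proof.
move=> T0 [zc [V zV]].
pose zj j := (fun t : R => z t j 0) : R -> R.
have zjc j : {within `[0, T], continuous (zj j)}.
  by move=> x; apply: (cvg_cV_coord (F := nbhs x)); exact: zc.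
have zjV j : bounded_variation 0 T (zj j).
  exists V => _ [s sP <-]; apply: le_trans (zV _ sP); rewrite /variation.
  apply: ler_sum => i _ /=; rewrite /zj.
  by have := normr_coord_le_enorm (z (nth T s i) - z (nth T (0 :: s) i)) j; rewrite !mxE.
have zjVt j t : 0 <= t -> t <= T -> total_variation 0 t (zj j) \is a fin_num.
  move=> t0 tT; apply/bounded_variationP => //.
  exact: (bounded_variationl t0 tT (zjV j)).
exists (fun t => \sum_j fine (total_variation 0 t (zj j))).
  move=> x; apply: (cvg_sumr (F := nbhs x)) => j.
  exact: (total_variation_continuous T0 (zjc j) (zjV j)).
move=> s t s0 st tT; apply: (le_trans (enorm_le_sum _)).
rewrite -sumrB; apply: ler_sum => j _.
have sT := le_trans st tT; have t0 := le_trans s0 st.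
have := total_variationD (zj j) s0 st.
rewrite -(fineK (zjVt j t t0 tT)) -(fineK (zjVt j s s0 sT)) => h.
have h2 := total_variation_ge (zj j) st.
rewrite !mxE -lee_fin EFinB h -addeAC subee// add0e.
exact: h2.
Qed.

End variation_clock.

(** * One-step estimates *)

Section scheme.
Variables (R : realType) (n : nat).
Local Notation E := 'cV[R]_n.
Implicit Types A : operator R n.

(** The substitute for monotonicity when the two pairs belong to different operators. *)
Lemma dis_le A B (rho : R) x y x' y' : (dis A B <= rho%:E)%E ->
  A x y -> B x' y' ->
  dotv (y - y') (x' - x) <= rho * (1 + enorm y + enorm y').
Proof.
move=> AB Axy Bxy.
have p0 : 0 < 1 + enorm y + enorm y'.
  by have := enorm_ge0 y; have := enorm_ge0 y'; lra.
rewrite -ler_pdivrMr// -lee_fin; apply: le_trans AB.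
by apply: ereal_sup_ubound; exists x, y, x', y'.
Qed.

(* Testing the resolvent equation against the minimal section at the previous
   point gives a quadratic inequality for [enorm y]. *)
Lemma resolvent_speed A0 A1 (rho delta dt q : R) (Y0 Y1 y y0 J : E) :
  (dis A1 A0 <= rho%:E)%E -> rho <= delta -> 0 <= dt -> dt <= delta ->
  0 < delta -> A0 Y0 y0 -> enorm y0 <= q -> A1 Y1 y ->
  Y0 - Y1 = delta *: y + dt *: J ->
  enorm y <= 2 * (1 + enorm J + q).
Proof.
move=> A01 rd dt0 dtd d0 A0y0 y0q A1y eqY.
have := dis_le A01 A1y A0y0; rewrite eqY !dotvE -sqr_enorm => h.
have h1 := normr_dotv y J; have h2 := dotv_le_enorm y0 y.
have h3 := dotv_le_enorm y0 J.
rewrite ler_norml in h1; case/andP: h1 => h1 _.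
have := enorm_ge0 y; have := enorm_ge0 J; have := enorm_ge0 y0.
move: (enorm y) (enorm J) (enorm y0) (dotv y J) (dotv y0 y) (dotv y0 J)
  h h1 h2 h3 y0q => s j p a1 a2 a3 h h1 h2 h3 pq p0 j0 s0.
have e1 : - (delta * (s * j)) <= dt * a1.
  have : 0 <= (delta - dt) * (s * j) by rewrite mulr_ge0 ?subr_ge0 ?mulr_ge0.
  have : dt * - (s * j) <= dt * a1 by rewrite ler_wpM2l.
  lra.
have e2 : delta * a2 <= delta * (q * s).
  by rewrite ler_pM2l// (le_trans h2)// ler_wpM2r.
have e3 : dt * a3 <= delta * (q * j).
  apply: (@le_trans _ _ (dt * (q * j))).
    by rewrite ler_wpM2l// (le_trans h3)// ler_wpM2r.
  by rewrite ler_wpM2r// mulr_ge0// (le_trans p0).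
have e4 : rho * (1 + s + p) <= delta * (1 + s + q).
  apply: (@le_trans _ _ (delta * (1 + s + p))).
    by rewrite ler_wpM2r// !addr_ge0.
  by rewrite ler_pM2l// lerD2l.
(* Every term now carries the factor [delta], which cancels. With [B = 1 + j + q] the remaining
   bound is at most [s * B + B ^ 2], which excludes [s > 2 * B]. *)
have e5 : delta * s ^+ 2 <= delta * (s * j + q * s + q * j + (1 + s + q)) by lra.
rewrite ler_pM2l// in e5.
have q0 := le_trans p0 pq.
rewrite leNgt; apply/negP => hs.
have d1 : 0 < s - 2 * (1 + j + q) by rewrite subr_gt0.
have := mulr_gt0 d1 d1; have := mulr_ge0 (ltW d1) (addr_ge0 (addr_ge0 ler01 j0) q0).
nra.
Qed.

Lemma telescope_le (f g : nat -> R) i j : (i <= j)%N ->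
  (forall k, (i <= k < j)%N -> f k.+1 - f k <= g k.+1 - g k) ->
  f j - f i <= g j - g i.
Proof.
move=> ij h; rewrite -!telescope_sumr// big_nat [leRHS]big_nat.
by apply: ler_sum.
Qed.

Lemma telescope_enorm (f : nat -> E) (g : nat -> R) i j : (i <= j)%N ->
  (forall k, (i <= k < j)%N -> enorm (f k.+1 - f k) <= g k.+1 - g k) ->
  enorm (f j - f i) <= g j - g i.
Proof.
move=> ij h; rewrite -!telescope_sumr//; apply: (le_trans (enorm_sum _ _ _)).
by rewrite big_nat [leRHS]big_nat; apply: ler_sum.
Qed.

End scheme.

(** The supremum is meaningful only once the image of the unit ball is bounded; the sum of the
    absolute entries gives a bound, and rescaling does the rest. *)
Lemma enorm_opnorm (R : realType) d e (f : 'M[R]_(e, d)) (x : 'cV[R]_d) :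
  enorm (f *m x) <= opnorm f * enorm x.
Proof.
have bnd (y : 'cV[R]_d) : enorm y <= 1 -> enorm (f *m y) <= \sum_i \sum_j `|f i j|.
  move=> y1; apply: (le_trans (enorm_le_sum _)); apply: ler_sum => i _.
  rewrite mxE; apply: (le_trans (ler_norm_sum _ _ _)); apply: ler_sum => j _.
  rewrite normrM ler_piMr// (le_trans _ y1)//; exact: normr_coord_le_enorm.
have supf : has_sup [set enorm (f *m x) | x in [set x : 'cV[R]_d | enorm x <= 1]].
  split; first by exists (enorm (f *m 0)), 0 => //=; rewrite enorm0.
  by exists (\sum_i \sum_j `|f i j|) => _ [y y1 <-]; exact: bnd.
have [x0|x0] := eqVneq (enorm x) 0.
  by rewrite (enorm_eq0 x0) mulmx0 !enorm0 mulr0.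
have xp : 0 < enorm x by rewrite lt_neqAle eq_sym x0 enorm_ge0.
rewrite -ler_pdivrMr//; apply: sup_upper_bound => //.
exists ((enorm x)^-1 *: x) => /=.
  by rewrite enormZ ger0_norm ?invr_ge0 ?enorm_ge0// mulVf.
by rewrite -scalemxAr enormZ ger0_norm ?invr_ge0 ?enorm_ge0// mulrC.
Qed.

(** Continuity of [b] is expressed in the max norm of matrices; this crude constant transfers its
    oscillation to Euclidean vectors. *)
Lemma enorm_mulmx_norm (R : realType) d e (f : 'M[R]_(e, d)) (x : 'cV[R]_d) :
  enorm (f *m x) <= (e * d)%:R * `|f| * enorm x.
Proof.
apply: (le_trans (enorm_le_sum _)).
apply: (@le_trans _ _ (\sum_(i < e) \sum_(j < d) (`|f| * enorm x))).
  apply: ler_sum => i _.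
  rewrite mxE; apply: (le_trans (ler_norm_sum _ _ _)); apply: ler_sum => j _.
  rewrite normrM ler_pM//; last exact: normr_coord_le_enorm.
  rewrite [leRHS]/Num.norm /= mx_normrE.
  exact: (le_bigmax _ (fun ij : 'I_e * 'I_d => `|f ij.1 ij.2|) (i, j)).
by rewrite !sumr_const !card_ord -mulrnA -mulrA mulr_natl mulnC.
Qed.

(** * The catching-up scheme *)

Section uniform_grid.
Variables (R : realType) (T : R).
Hypothesis T0 : 0 < T.

Definition grid (N i : nat) : R := i%:R * (T / N.+1%:R).

Lemma grid0 N : grid N 0 = 0.
Proof. by rewrite /grid mul0r. Qed.

Lemma gridT N : grid N N.+1 = T.
Proof. by rewrite /grid mulrC divfK// pnatr_eq0. Qed.

Lemma grid_step N : 0 < T / N.+1%:R.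
Proof. by rewrite divr_gt0// ltr0n. Qed.

Lemma gridS N i : grid N i.+1 = grid N i + T / N.+1%:R.
Proof. by rewrite /grid -natr1 mulrDl mul1r. Qed.

Lemma grid_le N i j : (i <= j)%N -> grid N i <= grid N j.
Proof. by move=> ij; rewrite /grid ler_wpM2r ?ler_nat// ltW// grid_step. Qed.

Lemma grid_ge0 N i : 0 <= grid N i.
Proof. by rewrite -(grid0 N) grid_le. Qed.

Lemma grid_leT N i : (i <= N.+1)%N -> grid N i <= T.
Proof. by move=> iN; rewrite -[leRHS](gridT N) grid_le. Qed.

Lemma grid_itv N i : (i <= N.+1)%N -> grid N i \in `[0, T].
Proof. by move=> iN; rewrite in_itv /= grid_ge0 grid_leT. Qed.

End uniform_grid.

Section discretization.
Variables (R : realType) (d e : nat) (T : R).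
Hypothesis T_gt0 : 0 < T.
Variable A : R -> operator R e.
Hypothesis A_max : forall t, t \in `[0, T] -> maximal_monotone (A t).
Variable r : R -> R.
Hypothesis r_nd : {in `[0, T] &, nondecreasing_fun r}.
Hypothesis H1 : forall s t, 0 <= s -> s <= t -> t <= T ->
     (dis (A t) (A s) <= (r t - r s)%:E)%E.
Variable c : R.
Hypothesis c_ge0 : 0 <= c.
Hypothesis H2 : forall t x, t \in `[0, T] -> domain (A t) x ->
     enorm (minimal_section (A t) x) <= c * (1 + enorm x).
Variables (z : R -> 'cV[R]_d) (w : R -> R).
Hypothesis zw : forall s t, 0 <= s -> s <= t -> t <= T ->
  enorm (z t - z s) <= w t - w s.
Variables (b : R -> 'cV[R]_e -> 'M[R]_(e, d)) (M : R).
Hypothesis M_ge0 : 0 <= M.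
Hypothesis b_bound : forall t x, t \in `[0, T] -> opnorm (b t x) <= M.
Variable a : 'cV[R]_e.
Hypothesis a_dom : domain (A 0) a.
Local Notation E := 'cV[R]_e.
Local Notation v := (fun t => t + r t).
Local Notation tau := (grid T).

Lemma clock_ltr s t : 0 <= s -> s < t -> t <= T -> s + r s < t + r t.
Proof.
move=> s0 st tT; rewrite ltr_leD// r_nd ?in_itv /= ?s0 ?tT ?(ltW st)//.
  by rewrite (le_trans (ltW st)).
by rewrite (le_trans s0 (ltW st)).
Qed.

Lemma variation_clock_le s t : 0 <= s -> s <= t -> t <= T -> w s <= w t.
Proof.
by move=> s0 st tT; rewrite -subr_ge0 (le_trans (enorm_ge0 _) (zw s0 st tT)).
Qed.

(* Implicit Euler (catching-up) scheme for [Y], explicit for the integral [J]: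
   [y i] is the selection of [A] at the new point. *)
Definition euler_scheme N (Y J y : nat -> E) :=
  [/\ Y 0 = a, J 0 = 0 & forall i, (i < N.+1)%N ->
    [/\ A (tau N i.+1) (Y i.+1) (y i),
      Y i - Y i.+1 = (v (tau N i.+1) - v (tau N i)) *: y i +
        (tau N i.+1 - tau N i) *: J i &
      J i.+1 = J i + b (tau N i) (J i + Y i) *m (z (tau N i.+1) - z (tau N i))]].

Lemma euler_scheme_exists N : exists Y J y, euler_scheme N Y J y.
Proof.
(* The bound on the index sits inside the relation so that [choice] yields a total step function,
   arbitrary beyond the last node. *)
have stepE : forall p : nat * (E * E), exists q : (E * E) * E, (p.1 < N.+1)%N ->
    [/\ A (tau N p.1.+1) q.1.1 q.2,
      p.2.1 - q.1.1 = (v (tau N p.1.+1) - v (tau N p.1)) *: q.2 +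
        (tau N p.1.+1 - tau N p.1) *: p.2.2 &
      q.1.2 = p.2.2 + b (tau N p.1) (p.2.2 + p.2.1) *m
        (z (tau N p.1.+1) - z (tau N p.1))].
  move=> [i [Y J]] /=; have [iN|] := ltnP i N.+1; last by exists (0, 0, 0).
  have d0 : 0 < v (tau N i.+1) - v (tau N i).
    rewrite subr_gt0 clock_ltr ?grid_ge0 ?grid_leT//.
    by rewrite gridS ltrDl grid_step.
  (* The step equation is [Y' + dv y = Y - dt J]: a resolvent of the operator at the new node, whose
     parameter is the increment of [v]. *)
  have [Y' [y [AY' eqY']]] := minty (Y - (tau N i.+1 - tau N i) *: J)
    (A_max (grid_itv T_gt0 iN)) d0.
  exists ((Y', J + b (tau N i) (J + Y) *m (z (tau N i.+1) - z (tau N i))), y) => _ /=.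
  split=> //; rewrite -[Y](subrK ((tau N i.+1 - tau N i) *: J)) -eqY'.
  by rewrite addrAC [Y' + _]addrC addrK.
have [step stepP] := choice stepE.
pose st := fix st i := if i is j.+1 then step (j, (st j).1) else ((a, 0), 0).
exists (fun i => (st i).1.1), (fun i => (st i).1.2), (fun i => (st i.+1).2).
split=> // i iN; have := stepP (i, (st i).1) iN; rewrite /=.
by case: (st i).1.
Qed.

(** [L] bounds [J]. Relative to [1 + enorm Y], [C1] bounds the speed [y], and [C2] that of [Y] in
    the time [v], drift [J] included. [G] is the resulting Gronwall bound on [1 + enorm Y]. *)
Let L := M * (w T - w 0).
Let C1 := 2 * (1 + L + c).
Let C2 := C1 + L.
Let G := (1 + enorm a) * expR (C2 * (v T - v 0)).

Let L0 : 0 <= L.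
Proof. by rewrite mulr_ge0// subr_ge0 variation_clock_le// ltW. Qed.

Let C10 : 0 <= C1.
Proof. by rewrite mulr_ge0// !addr_ge0. Qed.

Let C20 : 0 <= C2.
Proof. by rewrite addr_ge0. Qed.

Let G0 : 0 <= G.
Proof. by rewrite mulr_ge0 ?expR_ge0// addr_ge0// enorm_ge0. Qed.

Definition euler_bound := M + L + C1 * G + C2 * G + G.

Lemma euler_bound_ge0 : 0 <= euler_bound.
Proof. by rewrite !addr_ge0// mulr_ge0. Qed.

(** [J] is bounded first, without reference to [Y]. The induction on [Y] also carries membership in
    the domain, since (H2) bounds the minimal section only there; it starts from [a_dom] and each
    resolvent renews it. Growth is closed by [1 + x <= expR x]. *)
Lemma euler_scheme_bounds N Y J y : euler_scheme N Y J y ->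
  (forall i, (i < N.+1)%N ->
    [/\ enorm (y i) <= euler_bound,
      enorm (Y i.+1 - Y i) <= euler_bound * v (tau N i.+1) - euler_bound * v (tau N i) &
      enorm (J i.+1 - J i) <= euler_bound * w (tau N i.+1) - euler_bound * w (tau N i)]) /\
  (forall i, (i <= N.+1)%N -> enorm (Y i) <= euler_bound /\ enorm (J i) <= euler_bound).
Proof.
move=> [Y0 J0 YJ].
have Jstep i : (i < N.+1)%N -> enorm (J i.+1 - J i) <= M * w (tau N i.+1) - M * w (tau N i).
  move=> iN; have [_ _ ->] := YJ i iN.
  rewrite addrAC subrr add0r (le_trans (enorm_opnorm _ _))// -mulrBr.
  apply: (le_trans (ler_wpM2r (enorm_ge0 _) (b_bound _ (grid_itv T_gt0 (ltnW iN))))).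
  by rewrite ler_wpM2l// zw ?grid_ge0 ?grid_leT// grid_le.
have JL i : (i <= N.+1)%N -> enorm (J i) <= L.
  move=> iN; rewrite -[J i]subr0 -J0.
  apply: (@le_trans _ _ (M * w (tau N i) - M * w (tau N 0))).
    apply: (telescope_enorm (g := fun i => M * w (tau N i))) => // k /andP[_ ki].
    by apply: Jstep; exact: leq_trans ki iN.
  rewrite -mulrBr grid0 ler_wpM2l// lerD2r.
  by rewrite variation_clock_le ?grid_ge0 ?grid_leT.
have dt N' i : 0 < tau N' i.+1 - tau N' i by rewrite gridS addrAC subrr add0r grid_step.
have rstep i : (i < N.+1)%N -> 0 <= r (tau N i.+1) - r (tau N i).
  move=> iN; rewrite subr_ge0; apply: r_nd; rewrite ?grid_itv// ?(ltnW iN)//.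
  exact: grid_le.
have speed i : (i < N.+1)%N -> domain (A (tau N i)) (Y i) ->
    enorm (y i) <= C1 * (1 + enorm (Y i)) /\
    enorm (Y i.+1 - Y i) <=
      (v (tau N i.+1) - v (tau N i)) * (C2 * (1 + enorm (Y i))).
  move=> iN domY; have [AY eqY _] := YJ i iN.
  have iT := grid_itv T_gt0 (ltnW iN).
  have d0 := dt N i; have r0 := rstep i iN.
  have yC : enorm (y i) <= C1 * (1 + enorm (Y i)).
    have := resolvent_speed (H1 (grid_ge0 T_gt0 N i) (grid_le T_gt0 N (leqnSn i))
      (grid_leT T_gt0 iN)) _ (ltW d0) _ _ (minimal_section_mem (A_max iT) domY)
      (H2 iT domY) AY eqY.
    have h1 : r (tau N i.+1) - r (tau N i) <= v (tau N i.+1) - v (tau N i) by rewrite /=; lra.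
    have h2 : tau N i.+1 - tau N i <= v (tau N i.+1) - v (tau N i) by rewrite /=; lra.
    have h3 : 0 < v (tau N i.+1) - v (tau N i) by rewrite /=; lra.
    move=> /(_ h1 h2 h3) /le_trans; apply.
    have := JL i (ltnW iN); have := enorm_ge0 (Y i); have := L0.
    move: (enorm (Y i)) (enorm (J i)); rewrite /C1 => p q l0 p0 qL.
    by have := mulr_ge0 l0 p0; lra.
  split=> //.
  rewrite enormB eqY (le_trans (enormD _ _))// !enormZ gtr0_norm; last first.
    by rewrite /=; lra.
  rewrite gtr0_norm//.
  have := JL i (ltnW iN); have := enorm_ge0 (J i); have := enorm_ge0 (Y i).
  move: (enorm (Y i)) (enorm (J i)) (enorm (y i)) yC => p q s yC p0 q0 qL.
  apply: (@le_trans _ _ ((v (tau N i.+1) - v (tau N i)) * (C1 * (1 + p) + L))).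
    rewrite mulrDr lerD//; first by rewrite ler_wpM2l//=; lra.
    by apply: ler_pM => //; rewrite ?(ltW d0)//=; lra.
  rewrite ler_wpM2l//=; first lra.
  by rewrite /C2 mulrDl lerD2l; have := mulr_ge0 L0 p0; lra.
have growth i : (i <= N.+1)%N -> domain (A (tau N i)) (Y i) /\
    1 + enorm (Y i) <= (1 + enorm a) * expR (C2 * (v (tau N i) - v 0)).
  elim: i => [_|i ih iN]; first by rewrite grid0 Y0 subrr mulr0 expR0 mulr1.
  have [domY Yi] := ih (ltnW iN); have [AY _ _] := YJ i iN.
  split; first by exists (y i).
  have [_ dY] := speed i iN domY.
  have d0 := dt N i; have r0 := rstep i iN.
  pose del := v (tau N i.+1) - v (tau N i).
  apply: (@le_trans _ _ ((1 + enorm (Y i)) * (1 + C2 * del))).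
    have := enormD (Y i.+1 - Y i) (Y i); rewrite subrK => h.
    rewrite -/del in dY; lra.
  have del0 : 0 <= del by rewrite /del /=; lra.
  apply: (@le_trans _ _ ((1 + enorm a) * expR (C2 * (v (tau N i) - v 0)) * expR (C2 * del))).
    apply: ler_pM => //; first by rewrite addr_ge0// enorm_ge0.
      by rewrite addr_ge0// mulr_ge0.
    exact: expR_ge1Dx.
  rewrite -mulrA -expRD -mulrDr le_eqVlt; apply/orP; left; apply/eqP.
  by congr (_ * expR (_ * _)); rewrite /del /=; ring.
have YG i : (i <= N.+1)%N -> 1 + enorm (Y i) <= G.
  move=> iN; have [_ /le_trans] := growth i iN; apply.
  rewrite ler_wpM2l ?addr_ge0 ?enorm_ge0// ler_expR ler_wpM2l// lerD2r.
  rewrite lerD ?grid_leT// r_nd ?grid_itv ?grid_leT// in_itv /= lexx.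
  by rewrite ltW.
have KE : euler_bound = M + L + C1 * G + C2 * G + G by [].
have C1G := mulr_ge0 C10 G0; have C2G := mulr_ge0 C20 G0.
have l0 := L0; have g0 := G0; have m0 := M_ge0.
split=> i iN; last by have := YG i iN; have := JL i iN; split; lra.
have [domY _] := growth i (ltnW iN); have [s1 s2] := speed i iN domY.
have Yi := YG i (ltnW iN).
have d0 := dt N i; have r0 := rstep i iN.
split.
- apply: (le_trans s1); apply: (@le_trans _ _ (C1 * G)); last lra.
  by rewrite ler_wpM2l.
- apply: (le_trans s2); rewrite -mulrBr mulrC ler_wpM2r//=; first lra.
  apply: (@le_trans _ _ (C2 * G)); last lra.
  by rewrite ler_wpM2l.
- apply: (le_trans (Jstep i iN)); rewrite -!mulrBr ler_wpM2r//; last lra.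
  rewrite subr_ge0 variation_clock_le ?grid_ge0 ?grid_leT// grid_le//.
Qed.

End discretization.

(** * Uniform continuity and grid points on [[0, T]] *)

Lemma cvg_within_itv (R : realType) (V : topologicalType) (T : R) (f : R -> V)
    (I : Type) (F : set_system I) {FF : Filter F} (u : I -> R) (x : R) :
  {within `[0, T], continuous f} -> (forall i, u i \in `[0, T]) ->
  x \in `[0, T] -> u i @[i --> F] --> x -> f (u i) @[i --> F] --> f x.
Proof.
move=> /subspace_continuousP fc uT xT ux.
apply: cvg_trans (fc x xT); move=> P /= wP.
have {}wP : nbhs x [set y | y \in `[0, T] -> P (f y)] := wP.
have FU : F (fun i => u i \in `[0, T] -> P (f (u i))) := ux _ wP.
suff : F (fun i => P (f (u i))) by [].
by apply: filterS FU => i; apply; exact: uT.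
Qed.

Lemma ultra_infty : exists U : set_system nat, UltraFilter U /\ \oo `<=` U.
Proof. exact: ultraFilterLemma. Qed.

(** Otherwise two sequences at vanishing distance, with images more than [eps] apart, would converge
    along an ultrafilter to one point of [[0, T]], against continuity there. *)
Lemma heine_cantor_itv (R : realType) (V : normedModType R) (T : R) (f : R -> V) :
  {within `[0, T], continuous f} -> forall eps, 0 < eps ->
  exists2 delta, 0 < delta & forall s t, s \in `[0, T] -> t \in `[0, T] ->
    `|s - t| < delta -> `|f s - f t| <= eps.
Proof.
move=> fc eps e0; apply: contrapT => hn.
have /choice[p pP] : forall k : nat, exists p : R * R,
    [/\ p.1 \in `[0, T], p.2 \in `[0, T], `|p.1 - p.2| < k.+1%:R^-1 &
      eps < `|f p.1 - f p.2|].
  move=> k; apply: contrapT => hk; apply: hn; exists (k.+1%:R^-1); first by [].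
  move=> s t sT tT st; rewrite leNgt; apply/negP => fst_.
  by apply: hk; exists (s, t).
have [U [UU sU]] := ultra_infty.
have UP := @ultra_proper _ U UU.
have := @segment_compact R 0 T; rewrite compact_ultra => cT.
have [|x [xT /= ux]] := cT _ (ultra_fmap (fun k => (p k).1) UU).
  suff : U (fun k => (p k).1 \in `[0, T]) by [].
  by apply: filterE => k; have [] := pP k.
have xT' : x \in `[0, T] by [].
have ux' : (p k).1 @[k --> U] --> x by [].
have d0 : (p k).1 - (p k).2 @[k --> U] --> 0.
  apply/cvgrPdist_lt => d d0.
  have := near_infty_natSinv_lt (PosNum d0) => /= /sU; apply: filterS => k kd.
  by rewrite sub0r normrN; have [_ _ h _] := pP k; rewrite (lt_trans h).
have uy' : (p k).2 @[k --> U] --> x.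
  rewrite (_ : (fun k => (p k).2) = fun k => (p k).1 - ((p k).1 - (p k).2)).
    by rewrite -[X in _ --> X]subr0; exact: cvgB.
  by apply/funext => k; rewrite opprB addrC subrK.
have f1 : f (p k).1 @[k --> U] --> f x.
  by apply: (cvg_within_itv fc _ xT' ux') => k; have [] := pP k.
have f2 : f (p k).2 @[k --> U] --> f x.
  by apply: (cvg_within_itv fc _ xT' uy') => k; have [] := pP k.
have f0 : `|f (p k).1 - f (p k).2| @[k --> U] --> (0 : R).
  by rewrite -(normr0 V) -(subrr (f x)); apply: cvg_norm; exact: cvgB.
have : eps <= 0.
  apply: (ler_cvg (f := fun=> eps) (F := U) _ f0); first exact: cvg_cst.
  by apply: filterE => k; have [_ _ _ /ltW] := pP k.
by rewrite leNgt e0.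
Qed.

Section grid_index.
Variables (R : realType) (T : R).
Hypothesis T0 : 0 < T.

Definition grid_index (N : nat) (t : R) : nat := Num.truncn (t / (T / N.+1%:R)).

Definition grid_floor (t : R) (N : nat) : R := grid T N (grid_index N t).

Lemma grid_floor_itv N (t : R) : 0 <= t ->
  grid_floor t N <= t < grid T N (grid_index N t).+1.
Proof.
move=> t0; have h0 := grid_step T0 N.
have : 0 <= t / (T / N.+1%:R) by rewrite divr_ge0// ltW.
move=> /truncn_itv; rewrite ler_pdivlMr// ltr_pdivrMr//.
Qed.

Lemma grid_index_le N (t : R) : t <= T -> 0 <= t -> (grid_index N t <= N.+1)%N.
Proof.
move=> tT t0; have /andP[h _] := grid_floor_itv N t0.
rewrite -(@ler_nat R) -(ler_pM2r (grid_step T0 N)).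
by rewrite -/(grid T N N.+1) gridT (le_trans h).
Qed.

Lemma grid_index_homo N (s t : R) : 0 <= s -> s <= t -> (grid_index N s <= grid_index N t)%N.
Proof.
move=> s0 st; apply: le_truncn; rewrite ler_wpM2r// invr_ge0 ltW//.
exact: grid_step.
Qed.

Lemma grid_index0 N : grid_index N 0 = 0%N.
Proof. by rewrite /grid_index mul0r truncn0. Qed.

Lemma grid_floor_mem N (t : R) : t \in `[0, T] -> grid_floor t N \in `[0, T].
Proof.
rewrite in_itv /= => /andP[t0 tT]; apply: grid_itv => //.
exact: grid_index_le.
Qed.

Lemma grid_floor_cvg (t : R) : 0 <= t -> grid_floor t N @[N --> \oo] --> t.
Proof.
move=> t0; apply/cvgrPdist_lt => d d0.
have dT : 0 < d / T by rewrite divr_gt0.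
have := near_infty_natSinv_lt (PosNum dT); apply: filterS => N /= Nd.
have /andP[h1 h2] := grid_floor_itv N t0.
rewrite gridS in h2; rewrite ger0_norm ?subr_ge0//.
have h3 : T / N.+1%:R < d by rewrite mulrC -ltr_pdivlMr.
by rewrite ltrBlDr (lt_le_trans h2)// addrC lerD2r ltW.
Qed.

End grid_index.

(** * Limit of the scheme *)

Section euler_limit.
Variables (R : realType) (d e : nat) (T : R).
Hypothesis T_gt0 : 0 < T.
Variable A : R -> operator R e.
Variable r : R -> R.
Hypothesis r_cont : {within `[0, T], continuous r}.
Hypothesis r_nd : {in `[0, T] &, nondecreasing_fun r}.
Hypothesis H1 : forall s t, 0 <= s -> s <= t -> t <= T ->
     (dis (A t) (A s) <= (r t - r s)%:E)%E.
Variables (z : R -> 'cV[R]_d) (w : R -> R).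
Hypothesis z_cont : {within `[0, T], continuous z}.
Hypothesis w_cont : {within `[0, T], continuous w}.
Hypothesis zw : forall s t, 0 <= s -> s <= t -> t <= T ->
  enorm (z t - z s) <= w t - w s.
Variables (b : R -> 'cV[R]_e -> 'M[R]_(e, d)) (M : R).
Hypothesis b_cont : {within `[0, T] `*` [set: 'cV[R]_e],
     continuous (fun p : R * 'cV[R]_e => b p.1 p.2)}.
Hypothesis M_ge0 : 0 <= M.
Hypothesis b_lip : forall t x y, t \in `[0, T] ->
     opnorm (b t x - b t y) <= M * enorm (x - y).
Variables (a : 'cV[R]_e) (K : R).
Local Notation E := 'cV[R]_e.
Local Notation v := (fun t : R => t + r t).
Local Notation tau := (grid T).
Variables (Yn Jn yn : nat -> nat -> E).
Hypothesis K_ge0 : 0 <= K.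
Hypothesis schemeP : forall N, euler_scheme T A r z b a N (Yn N) (Jn N) (yn N).
Hypothesis stepP : forall N i, (i < N.+1)%N ->
    [/\ enorm (yn N i) <= K,
      enorm (Yn N i.+1 - Yn N i) <= K * v (tau N i.+1) - K * v (tau N i) &
      enorm (Jn N i.+1 - Jn N i) <= K * w (tau N i.+1) - K * w (tau N i)].
Hypothesis boundP : forall N i, (i <= N.+1)%N ->
  enorm (Yn N i) <= K /\ enorm (Jn N i) <= K.

(** * Estimates at a fixed mesh *)

Section discrete.
Variable N : nat.
Local Notation Y := (Yn N).
Local Notation J := (Jn N).
Local Notation y := (yn N).

Lemma Yn_incr i j : (i <= j)%N -> (j <= N.+1)%N ->
  enorm (Y j - Y i) <= K * v (tau N j) - K * v (tau N i).
Proof.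
move=> ij jN; apply: (telescope_enorm (g := fun i => K * v (tau N i))) => //.
move=> k /andP[_ kj].
by have [_ -> _] := stepP (leq_trans kj jN).
Qed.

Lemma Jn_incr i j : (i <= j)%N -> (j <= N.+1)%N ->
  enorm (J j - J i) <= K * w (tau N j) - K * w (tau N i).
Proof.
move=> ij jN; apply: (telescope_enorm (g := fun i => K * w (tau N i))) => //.
move=> k /andP[_ kj].
by have [_ _ ->] := stepP (leq_trans kj jN).
Qed.

Lemma v_grid_le i j : (i <= j)%N -> (j <= N.+1)%N -> v (tau N i) <= v (tau N j).
Proof.
move=> ij jN; rewrite lerD ?grid_le// r_nd ?grid_itv ?(leq_trans ij)//.
exact: grid_le.
Qed.

Lemma w_grid_le i j : (i <= j)%N -> (j <= N.+1)%N -> w (tau N i) <= w (tau N j).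
Proof.
by move=> ij jN; apply: (variation_clock_le zw); rewrite ?grid_ge0 ?grid_le ?grid_leT.
Qed.

(** Over one step, half the squared distance to [xi] grows by at most
    [dotv (Y k - Y k.+1) (xi - Y k.+1)]. The [y] part is compared with [eta] through [dis], the [J]
    part is frozen at node [p], and the errors are charged to increments of [v] and [w] over the
    whole block. Node [p] may precede [s]: [y k] belongs to the operator at node [k.+1], so only
    later nodes must come after [s]. *)
Lemma discrete_energy p q (s t' : R) (xi eta : E) : (p <= q)%N -> (q <= N.+1)%N ->
  s \in `[0, T] -> t' \in `[0, T] -> s <= tau N p.+1 -> tau N q <= t' ->
  A s xi eta ->
  dotv (Y q - xi) (Y q - xi) / 2 - dotv (Y p - xi) (Y p - xi) / 2 <=
  (v (tau N q) - v (tau N p)) *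
    (dotv eta (xi - Y p) + (1 + K + enorm eta) * (r t' - r s) +
     (enorm eta * K + K * K) * (v (tau N q) - v (tau N p)) +
     K * (enorm xi + K) * (w (tau N q) - w (tau N p))) +
  (tau N q - tau N p) * dotv (J p) (xi - Y p).
Proof.
move=> pq qN sT t'T sp qt' Asxe.
set E0 := (X in _ <= _ * X + _); set D := dotv (J p) (xi - Y p).
suff : dotv (Y q - xi) (Y q - xi) / 2 - dotv (Y p - xi) (Y p - xi) / 2 <=
    (v (tau N q) * E0 + tau N q * D) - (v (tau N p) * E0 + tau N p * D) by lra.
apply: (telescope_le (f := fun k => dotv (Y k - xi) (Y k - xi) / 2)
  (g := fun k => v (tau N k) * E0 + tau N k * D)) => // k /andP[pk kq].
have kN : (k < N.+1)%N := leq_trans kq qN.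
have [_ _ /(_ k kN)[AY eqY _]] := schemeP N.
have [yK _ _] := stepP kN.
have k1T : tau N k.+1 <= T by apply: grid_leT.
have [s0 sT'] : 0 <= s /\ s <= T by move: sT; rewrite in_itv => /andP.
have sk : s <= tau N k.+1 by rewrite (le_trans sp)// grid_le.
have kt' : tau N k.+1 <= t' by rewrite (le_trans _ qt')// grid_le.
have rk : r (tau N k.+1) <= r t' by apply: r_nd => //; exact: grid_itv.
have rs : r s <= r (tau N k.+1) by apply: r_nd => //; exact: grid_itv.
have i1 : dotv (y k - eta) (xi - Y k.+1) <= (1 + K + enorm eta) * (r t' - r s).
  apply: (le_trans (dis_le (H1 s0 sk k1T) AY Asxe)).
  rewrite mulrC; apply: ler_pM; rewrite ?subr_ge0 ?lerD2r ?lerD2l//.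
  by rewrite !addr_ge0 ?enorm_ge0.
have Ykp : enorm (Y p - Y k.+1) <= K * (v (tau N q) - v (tau N p)).
  rewrite enormB (le_trans (Yn_incr (leqW pk) kN))// mulrBr lerD2r ler_wpM2l//.
  exact: v_grid_le.
have Jkp : enorm (J k - J p) <= K * (w (tau N q) - w (tau N p)).
  rewrite (le_trans (Jn_incr pk (ltnW kN)))// mulrBr lerD2r ler_wpM2l//.
  by apply: w_grid_le => //; exact: ltnW.
have i2 : dotv eta (xi - Y k.+1) <= dotv eta (xi - Y p) +
    enorm eta * (K * (v (tau N q) - v (tau N p))).
  rewrite -(subrKA (Y p) xi (- Y k.+1)) [leLHS]dotvDr lerD2l.
  by rewrite (le_trans (dotv_le_enorm _ _))// ler_wpM2l// enorm_ge0.
have [YpK JpK] := boundP (leq_trans pq qN).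
have [YkK _] := boundP kN.
have i3 : dotv (J k) (xi - Y k.+1) <= D + K * (K * (v (tau N q) - v (tau N p))) +
    K * (w (tau N q) - w (tau N p)) * (enorm xi + K).
  rewrite -[J k](subrK (J p)) dotvDl [leLHS]addrC lerD//.
    rewrite /D -(subrKA (Y p) xi (- Y k.+1)) [leLHS]dotvDr lerD2l.
    by rewrite (le_trans (dotv_le_enorm _ _))// ler_pM// enorm_ge0.
  rewrite (le_trans (dotv_le_enorm _ _))// ler_pM// ?enorm_ge0//.
  by rewrite (le_trans (enormD _ _))// enormN lerD2l.
have step0 : dotv (Y k.+1 - xi) (Y k.+1 - xi) / 2 - dotv (Y k - xi) (Y k - xi) / 2
    <= dotv (Y k - Y k.+1) (xi - Y k.+1).
  have := dotv_ge0 (Y k - Y k.+1).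
  rewrite !dotvE (dotvC (Y k.+1) (Y k)) (dotvC xi (Y k)) (dotvC xi (Y k.+1)); lra.
apply: (le_trans step0); rewrite eqY dotvDl !dotvZl.
have dtau : tau N k <= tau N k.+1 by rewrite grid_le.
have drk : r (tau N k) <= r (tau N k.+1).
  by apply: r_nd => //; apply: grid_itv => //; exact: ltnW.
(* The part of [E0] reserved for freezing [J] and [Y] at node [p] in the drift term; its factor, a
   time step, is enlarged to an increment of [v]. *)
pose er := K * (K * (v (tau N q) - v (tau N p))) +
    K * (w (tau N q) - w (tau N p)) * (enorm xi + K).
have er0 : 0 <= er.
  rewrite addr_ge0// !mulr_ge0// ?subr_ge0 ?v_grid_le ?w_grid_le//.
  by rewrite addr_ge0// enorm_ge0.
have j1 : (tau N k.+1 - tau N k) * dotv (J k) (xi - Y k.+1) <=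
    (tau N k.+1 - tau N k) * D + (v (tau N k.+1) - v (tau N k)) * er.
  apply: (@le_trans _ _ ((tau N k.+1 - tau N k) * (D + er))).
    by rewrite ler_wpM2l ?subr_ge0// addrA.
  by rewrite mulrDr lerD2l ler_wpM2r//; lra.
have j2 : (v (tau N k.+1) - v (tau N k)) * dotv (y k) (xi - Y k.+1) <=
    (v (tau N k.+1) - v (tau N k)) * (E0 - er).
  apply: ler_wpM2l; first by rewrite /=; lra.
  rewrite dotvBl in i1; rewrite /E0 /er; lra.
rewrite /= in j1 j2 *; lra.
Qed.

(** Subtracting [G *m z] from [J] leaves increments [(b - G) *m dz], bounded by [om] times those of
    [w]; the bounds telescope. *)
Lemma discrete_RS p q (G : 'M[R]_(e, d)) om : (p <= q)%N -> (q <= N.+1)%N ->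
  (forall k x, (p <= k < q)%N ->
     enorm ((b (tau N k) (J k + Y k) - G) *m x) <= om * enorm x) ->
  0 <= om ->
  enorm (J q - J p - G *m (z (tau N q) - z (tau N p))) <=
    om * (w (tau N q) - w (tau N p)).
Proof.
move=> pq qN h om0.
have -> : J q - J p - G *m (z (tau N q) - z (tau N p)) =
    (J q - G *m z (tau N q)) - (J p - G *m z (tau N p)).
  by rewrite mulmxBr !opprD !opprK addrACA.
rewrite mulrBr.
apply: (telescope_enorm (f := fun k => J k - G *m z (tau N k))
  (g := fun k => om * w (tau N k))) => // k /andP[pk kq].
have kN : (k < N.+1)%N := leq_trans kq qN.
have [_ _ /(_ k kN)[_ _ ->]] := schemeP N.
have -> : J k + b (tau N k) (J k + Y k) *m (z (tau N k.+1) - z (tau N k)) -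
    G *m z (tau N k.+1) - (J k - G *m z (tau N k)) =
    (b (tau N k) (J k + Y k) - G) *m (z (tau N k.+1) - z (tau N k)).
  rewrite mulmxBl (mulmxBr G) !opprD !opprK addrACA.
  by rewrite [J k + _]addrC addrK.
rewrite (le_trans (h _ _ _)) ?pk ?kq// -mulrBr ler_wpM2l//.
by apply: zw; rewrite ?grid_ge0 ?grid_le ?grid_leT.
Qed.

End discrete.
(** Bounded values converge along any ultrafilter, so a single one finer than [\oo] serves all times
    at once. *)
Lemma euler_limit_exists : exists (U : set_system nat) (Y J : R -> E),
  [/\ ProperFilter U, \oo `<=` U &
    forall t, t \in `[0, T] ->
      Yn N (grid_index T N t) @[N --> U] --> Y t /\
      Jn N (grid_index T N t) @[N --> U] --> J t].
Proof.
have [U [UU sU]] := ultra_infty.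
have UP := @ultra_proper _ U UU.
have lim t : exists YJ : E * E, t \in `[0, T] ->
    Yn N (grid_index T N t) @[N --> U] --> YJ.1 /\
    Jn N (grid_index T N t) @[N --> U] --> YJ.2.
  have [|tT] := boolP (t \in `[0, T]); last by exists (0, 0).
  rewrite in_itv /= => /andP[t0 tT].
  have bnd N := boundP (grid_index_le T_gt0 N tT t0).
  have bY : \forall N \near U, enorm (Yn N (grid_index T N t)) <= K.
    by apply: filterE => N; have [] := bnd N.
  have bJ : \forall N \near U, enorm (Jn N (grid_index T N t)) <= K.
    by apply: filterE => N; have [] := bnd N.
  have [Y YP] := cvg_ultra_bounded UU bY.
  have [J JP] := cvg_ultra_bounded UU bJ.
  by exists (Y, J).
have /choice[YJ YJP] := lim.
by exists U, (fun t => (YJ t).1), (fun t => (YJ t).2); split=> // t /YJP.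
Qed.

(** * Properties of the limit curves *)

Section limit_properties.
Variables (U : set_system nat) (Y J : R -> E).
Context {UP : ProperFilter U}.
Hypothesis sU : \oo `<=` U.
Hypothesis Ylim : forall t, t \in `[0, T] ->
  Yn N (grid_index T N t) @[N --> U] --> Y t.
Hypothesis Jlim : forall t, t \in `[0, T] ->
  Jn N (grid_index T N t) @[N --> U] --> J t.
Local Notation fl := (grid_floor T).
Local Notation ix := (grid_index T).

Lemma fl_cvg (t : R) : t \in `[0, T] -> fl t N @[N --> U] --> t.
Proof.
move=> tT; apply: cvg_trans (grid_floor_cvg T_gt0 _); last first.
  by move: tT; rewrite in_itv /= => /andP[].
by move=> P; apply: sU.
Qed.

Lemma cvg_fl (V : topologicalType) (f : R -> V) (t : R) :
  {within `[0, T], continuous f} -> t \in `[0, T] -> f (fl t N) @[N --> U] --> f t.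
Proof.
move=> fc tT; apply: (cvg_within_itv fc) => //; last exact: fl_cvg.
by move=> N; exact: grid_floor_mem.
Qed.

Lemma clock_within_continuous : {within `[0, T], continuous v}.
Proof.
have idc : {within `[0, T], continuous (fun t : R => t)}.
  by apply: continuous_subspaceT => x; exact: cvg_id.
by move=> x; apply: (cvgD (F := nbhs x)); [exact: idc|exact: r_cont].
Qed.

Lemma limit_Y0 : Y 0 = a.
Proof.
have T0' : 0 \in `[0, T] by rewrite in_itv /= lexx ltW.
apply: (cvg_unique (@norm_hausdorff _ _) (Ylim T0')).
rewrite (_ : (fun N => _) = fun=> a); first exact: cvg_cst.
by apply/funext => N; rewrite grid_index0; have [] := schemeP N.
Qed.

Lemma limit_J0 : J 0 = 0.
Proof.
have T0' : 0 \in `[0, T] by rewrite in_itv /= lexx ltW.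
apply: (cvg_unique (@norm_hausdorff _ _) (Jlim T0')).
rewrite (_ : (fun N => _) = fun=> 0); first exact: cvg_cst.
by apply/funext => N; rewrite grid_index0; have [] := schemeP N.
Qed.

Lemma itv_subset_mem (s t : R) : 0 <= s -> s <= t -> t <= T ->
  (s \in `[0, T]) * (t \in `[0, T]).
Proof.
by move=> s0 st tT; rewrite !in_itv /= s0 tT (le_trans st) // (le_trans s0).
Qed.

Lemma limit_Y_incr (s t : R) : 0 <= s -> s <= t -> t <= T ->
  enorm (Y t - Y s) <= K * (v t - v s).
Proof.
move=> s0 st tT; have [sI tI] := itv_subset_mem s0 st tT.
have t0 := le_trans s0 st.
apply: (ler_cvg (cvg_enorm (cvgB (Ylim tI) (Ylim sI)))
  (cvgM (cvg_cst K) (cvgB (cvg_fl clock_within_continuous tI)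
    (cvg_fl clock_within_continuous sI)))).
apply: filterE => N; rewrite /= mulrBr; apply: Yn_incr.
  exact: grid_index_homo.
exact: grid_index_le.
Qed.

Lemma limit_J_incr (s t : R) : 0 <= s -> s <= t -> t <= T ->
  enorm (J t - J s) <= K * (w t - w s).
Proof.
move=> s0 st tT; have [sI tI] := itv_subset_mem s0 st tT.
have t0 := le_trans s0 st.
apply: (ler_cvg (cvg_enorm (cvgB (Jlim tI) (Jlim sI)))
  (cvgM (cvg_cst K) (cvgB (cvg_fl w_cont tI) (cvg_fl w_cont sI)))).
apply: filterE => N; rewrite /= mulrBr; apply: Jn_incr.
  exact: grid_index_homo.
exact: grid_index_le.
Qed.

Lemma limit_energy (s t : R) (xi eta : E) : 0 <= s -> s <= t -> t <= T ->
  A s xi eta ->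
  dotv (Y t - xi) (Y t - xi) / 2 - dotv (Y s - xi) (Y s - xi) / 2 <=
  (v t - v s) *
    (dotv eta (xi - Y s) + (1 + K + enorm eta) * (r t - r s) +
     (enorm eta * K + K * K) * (v t - v s) +
     K * (enorm xi + K) * (w t - w s)) +
  (t - s) * dotv (J s) (xi - Y s).
Proof.
move=> s0 st tT Asxe; have [sI tI] := itv_subset_mem s0 st tT.
have t0 := le_trans s0 st.
have Yt : Yn N (ix N t) - xi @[N --> U] --> Y t - xi.
  by apply: cvgB; [exact: Ylim|exact: cvg_cst].
have Ys : Yn N (ix N s) - xi @[N --> U] --> Y s - xi.
  by apply: cvgB; [exact: Ylim|exact: cvg_cst].
have Ys' : xi - Yn N (ix N s) @[N --> U] --> xi - Y s.
  by apply: cvgB; [exact: cvg_cst|exact: Ylim].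
have vts : v (fl t N) - v (fl s N) @[N --> U] --> v t - v s.
  by apply: cvgB; exact: (cvg_fl clock_within_continuous).
have wts : w (fl t N) - w (fl s N) @[N --> U] --> w t - w s.
  by apply: cvgB; exact: (cvg_fl w_cont).
pose f N := dotv (Yn N (ix N t) - xi) (Yn N (ix N t) - xi) / 2 -
  dotv (Yn N (ix N s) - xi) (Yn N (ix N s) - xi) / 2.
pose g N := (v (fl t N) - v (fl s N)) *
    (dotv eta (xi - Yn N (ix N s)) + (1 + K + enorm eta) * (r t - r s) +
     (enorm eta * K + K * K) * (v (fl t N) - v (fl s N)) +
     K * (enorm xi + K) * (w (fl t N) - w (fl s N))) +
  (fl t N - fl s N) * dotv (Jn N (ix N s)) (xi - Yn N (ix N s)).
apply: (ler_cvg (f := f) (g := g) (F := U)).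
- apply: cvgB; (apply: cvgM; last exact: cvg_cst).
    exact: (cvg_dotv Yt Yt).
  exact: (cvg_dotv Ys Ys).
- apply: cvgD; last first.
    apply: cvgM; first exact: (cvgB (fl_cvg tI) (fl_cvg sI)).
    exact: (cvg_dotv (Jlim sI) Ys').
  apply: cvgM; first exact: vts.
  apply: cvgD; last by apply: cvgM; [exact: cvg_cst|exact: wts].
  apply: cvgD; last by apply: cvgM; [exact: cvg_cst|exact: vts].
  by apply: cvgD; [exact: (cvg_dotv (cvg_cst eta) Ys')|exact: cvg_cst].
apply: filterE => N; apply: discrete_energy => //.
- exact: grid_index_homo.
- exact: grid_index_le.
- by have /andP[_ /ltW] := grid_floor_itv T_gt0 N s0.
- by have /andP[] := grid_floor_itv T_gt0 N t0.
Qed.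

Local Notation X := (fun t => J t + Y t).
Local Notation m := (fun t => K * v t + K * w t).
Local Notation F := (fun t => b t (X t)).

Lemma limit_X_incr (s t : R) : 0 <= s -> s <= t -> t <= T ->
  enorm (X t - X s) <= m t - m s.
Proof.
move=> s0 st tT; rewrite /= opprD addrACA (le_trans (enormD _ _))//.
have := limit_Y_incr s0 st tT; have := limit_J_incr s0 st tT.
rewrite /=; lra.
Qed.

Lemma modulus_within_continuous : {within `[0, T], continuous m}.
Proof.
move=> x; apply: (cvgD (F := nbhs x)); apply: (cvgM (F := nbhs x)).
- exact: cvg_cst.
- exact: clock_within_continuous.
- exact: cvg_cst.
- exact: w_cont.
Qed.

Lemma continuous_of_incr (f : R -> E) (g : R -> R) : {within `[0, T], continuous g} ->
  (forall s t, 0 <= s -> s <= t -> t <= T -> enorm (f t - f s) <= g t - g s) ->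
  {within `[0, T], continuous f}.
Proof.
move=> gc fg; apply/subspace_continuousP => x xT.
have /subspace_continuousP/(_ x xT) gx := gc.
have xI : x \in `[0, T] by [].
apply: cvg_enormB; apply/cvgrPdist_lt => eps e0.
have /cvgrPdist_lt/(_ _ e0) := gx.
rewrite !near_withinE; apply: filterS => y h yT.
have {}h : `|g x - g y| < eps := h yT.
move: xI (yT : y \in `[0, T]); rewrite !in_itv /= => /andP[x0 xT'] /andP[y0 yT'].
rewrite sub0r normrN ger0_norm ?enorm_ge0//; apply: le_lt_trans h.
have [xy|/ltW yx] := leP x y.
  by rewrite (le_trans (fg _ _ x0 xy yT'))// distrC ler_norm.
by rewrite enormB (le_trans (fg _ _ y0 yx xT'))// ler_norm.
Qed.

Lemma limit_X_continuous : {within `[0, T], continuous X}.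
Proof. exact: (continuous_of_incr modulus_within_continuous limit_X_incr). Qed.

Lemma limit_b_continuous : {within `[0, T], continuous F}.
Proof.
apply/subspace_continuousP => x xT.
have /subspace_continuousP/(_ (x, X x) (conj xT I)) bc := b_cont.
have /subspace_continuousP/(_ x xT) Xc := limit_X_continuous.
apply: (cvg_comp (fun t => (t, X t)) (fun p : R * E => b p.1 p.2) _ bc).
move=> P /= wP.
have {}wP : nbhs (x, X x) [set p | (`[0, T] `*` [set: E]) p -> P p] := wP.
have pc : (t, X t) @[t --> within `[0, T] (nbhs x)] --> (x, X x).
  have idc : t @[t --> within `[0, T]%classic (nbhs x)] --> x by exact: cvg_within.
  exact: (cvg_pair idc Xc).
have h : nbhs x (fun t => t \in `[0, T] ->
    (`[0, T] `*` [set: E]) (t, X t) -> P (t, X t)) := pc _ wP.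
suff : nbhs x (fun t => t \in `[0, T] -> P (t, X t)) by [].
by apply: (@filterS _ (nbhs x) _ _ _ _ h) => t ht tT; exact: ht.
Qed.

(** The coefficients are compared without uniform convergence: the approximate curve is close to [X]
    at [p], and from there to any node of the block both curves move by increments of [m], whence
    [2 * (m q - m p)]. The slack [ep] makes room for the node below [p], which may lie outside
    [[p, q]] but converges to [p]. *)
Lemma limit_RS_local (p q tg om ep : R) : 0 <= p -> p <= tg -> tg <= q -> q <= T ->
  0 <= om -> 0 < ep ->
  (forall s x, s \in `[0, T] -> p - ep <= s -> s <= q ->
    enorm ((F s - F tg) *m x) <= om * enorm x) ->
  enorm (J q - J p - F tg *m (z q - z p)) <=
    (om + M * (2 * (m q - m p))) * (w q - w p).
Proof.
move=> p0 pt tq qT om0 ep0 h.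
have pq := le_trans pt tq; have q0 := le_trans p0 pq.
have [pI qI] := itv_subset_mem p0 pq qT.
pose Xp N := Jn N (ix N p) + Yn N (ix N p).
pose er N := enorm (Xp N - X p) + (m p - m (fl p N)).
have er_cvg : er N @[N --> U] --> 0.
  have Xpc : Xp N @[N --> U] --> X p by exact: (cvgD (Jlim pI) (Ylim pI)).
  have -> : 0 = enorm (X p - X p) + (m p - m p) by rewrite !subrr enorm0 addr0.
  apply: cvgD; first by apply: cvg_enorm; apply: cvgB; [exact: Xpc|exact: cvg_cst].
  by apply: cvgB; [exact: cvg_cst|exact: (cvg_fl modulus_within_continuous)].
have mulc (u : nat -> 'cV[R]_d) (l : 'cV[R]_d) :
    u N @[N --> U] --> l -> F tg *m u N @[N --> U] --> F tg *m l.
  move=> ul; apply: cvg_cV => i; rewrite mxE.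
  under eq_fun do rewrite mxE.
  by apply: cvg_sumr => j; apply: cvgM; [exact: cvg_cst|exact: cvg_cV_coord].
pose f N := enorm (Jn N (ix N q) - Jn N (ix N p) -
  F tg *m (z (fl q N) - z (fl p N))).
pose g N := (om + M * (er N + 2 * (m (fl q N) - m (fl p N)))) *
  (w (fl q N) - w (fl p N)).
have fc : f N @[N --> U] --> enorm (J q - J p - F tg *m (z q - z p)).
  apply: cvg_enorm; apply: cvgB; first by apply: cvgB; exact: Jlim.
  by apply: mulc; apply: cvgB; exact: (cvg_fl z_cont).
have gc : g N @[N --> U] --> (om + M * (0 + 2 * (m q - m p))) * (w q - w p).
  apply: cvgM; last by apply: cvgB; exact: (cvg_fl w_cont).
  apply: cvgD; first exact: cvg_cst.
  apply: cvgM; first exact: cvg_cst.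
  apply: cvgD; first exact: er_cvg.
  by apply: cvgM; [exact: cvg_cst|apply: cvgB; exact: (cvg_fl modulus_within_continuous)].
rewrite -[2 * _]add0r; apply: (ler_cvg fc gc).
have near_p : \forall N \near U, p - ep <= fl p N.
  have := fl_cvg pI => /cvgrPdist_le/(_ _ ep0); apply: filterS => N.
  by rewrite ler_norml => /andP[_]; lra.
apply: filterS near_p => N pep /=.
have pqN : (ix N p <= ix N q)%N by exact: grid_index_homo.
have qN : (ix N q <= N.+1)%N by exact: grid_index_le.
have mle i j : (i <= j)%N -> (j <= N.+1)%N -> m (tau N i) <= m (tau N j).
  by move=> ij jN; rewrite lerD ?ler_wpM2l// ?v_grid_le ?w_grid_le.
have mle' (s t : R) : 0 <= s -> s <= t -> t <= T -> m s <= m t.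
  by move=> s0 st tT; rewrite -subr_ge0 (le_trans (enorm_ge0 _) (limit_X_incr s0 st tT)).
have /andP[flp _] := grid_floor_itv T_gt0 N p0.
have /andP[flq _] := grid_floor_itv T_gt0 N q0.
have er0 : 0 <= er N.
  rewrite addr_ge0 ?enorm_ge0// subr_ge0; apply: mle' => //; last exact: (le_trans pq qT).
  exact: grid_ge0.
apply: discrete_RS => //; last first.
  rewrite addr_ge0// mulr_ge0// addr_ge0// mulr_ge0// subr_ge0.
  exact: mle.
move=> k x /andP[pk kq].
have kN : (k <= N.+1)%N := leq_trans (ltnW kq) qN.
have kI := grid_itv T_gt0 kN.
have fpk : fl p N <= tau N k by exact: grid_le.
have kfq : tau N k <= fl q N by apply: grid_le => //; exact: ltnW.
have k0 := grid_ge0 T_gt0 N k.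
have kT := grid_leT T_gt0 kN.
have Xk : enorm (Jn N k + Yn N k - X (tau N k)) <= er N + 2 * (m (fl q N) - m (fl p N)).
  have e1 : enorm (Jn N k + Yn N k - Xp N) <= m (tau N k) - m (fl p N).
    rewrite /Xp opprD addrACA (le_trans (enormD _ _))//.
    have := Yn_incr pk kN; have := Jn_incr pk kN.
    by rewrite /grid_floor /=; lra.
  have e2 : enorm (X p - X (tau N k)) <= (m (fl q N) - m (fl p N)) + (m p - m (fl p N)).
    have mkq : m (tau N k) <= m (fl q N) by apply: mle => //; exact: ltnW.
    have mpk : m (fl p N) <= m (tau N k) by apply: mle.
    have mp : m (fl p N) <= m p.
      by apply: mle' => //; [exact: grid_ge0|exact: (le_trans pq qT)].
    have [kp|/ltW kp] := leP p (tau N k).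
      rewrite enormB (le_trans (limit_X_incr p0 kp kT))//.
      by rewrite /= in mkq mpk mp *; lra.
    rewrite (le_trans (limit_X_incr k0 kp (le_trans pq qT)))//.
    by rewrite /= in mkq mpk mp *; lra.
  have mkq : m (tau N k) <= m (fl q N) by apply: mle => //; exact: ltnW.
  apply: (le_trans (enormBD _ (Xp N) _)).
  have := enormBD (Xp N) (X p) (X (tau N k)).
  by rewrite /er; rewrite /= in e1 e2 mkq *; lra.
have -> : b (tau N k) (Jn N k + Yn N k) - F tg =
    (b (tau N k) (Jn N k + Yn N k) - F (tau N k)) + (F (tau N k) - F tg).
  by rewrite /= addrA subrK.
rewrite mulmxDl (le_trans (enormD _ _))// mulrDl addrC lerD//.
  by apply: h => //; [exact: (le_trans pep fpk)|exact: (le_trans kfq flq)].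
rewrite (le_trans (enorm_opnorm _ _))// ler_wpM2r ?enorm_ge0//.
rewrite (le_trans (b_lip _ _ kI))// ler_wpM2l//.
Qed.

Lemma limit_RS (t : R) : t \in `[0, T] -> is_RS_integral F z 0 t (J t).
Proof.
rewrite in_itv /= => /andP[t0 tT] eps e0.
have w0T : w 0 <= w T by apply: (variation_clock_le zw) => //; exact: ltW.
pose W := w T - w 0; have W0 : 0 <= W by rewrite subr_ge0.
(* Each subinterval will cost [2 * om] times its increment of [w]: one [om] for the oscillation of
   the coefficient, one for the increment of [m]. The [+ 1] covers [W = 0]. *)
pose om := eps / (4 * (W + 1)).
have om0 : 0 < om by rewrite divr_gt0// mulr_gt0// ltr_wpDl.
have omW : 2 * om * W < eps.
  have -> : eps = 4 * om * (W + 1) by rewrite /om; field; lra.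
  by have := mulr_ge0 (ltW om0) W0; lra.
have [d1 d10 Fd1] : exists2 d1, 0 < d1 & forall s s' x, s \in `[0, T] ->
    s' \in `[0, T] -> `|s - s'| < d1 -> enorm ((F s - F s') *m x) <= om * enorm x.
  have c0 : 0 < om / ((e * d)%:R + 1) by rewrite divr_gt0// ltr_wpDl.
  have [d1 d10 h] := heine_cantor_itv limit_b_continuous c0.
  exists d1 => // s s' x sI s'I ss'; rewrite (le_trans (enorm_mulmx_norm _ _))//.
  rewrite ler_wpM2r ?enorm_ge0//.
  apply: (@le_trans _ _ (((e * d)%:R + 1) * (om / ((e * d)%:R + 1)))).
    by rewrite ler_pM// ?lerDl//; exact: h.
  by rewrite mulrC divfK// gt_eqF// ltr_wpDl.
have [d2 d20 md2] : exists2 d2, 0 < d2 & forall s s', s \in `[0, T] ->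
    s' \in `[0, T] -> `|s - s'| < d2 -> M * (2 * (m s - m s')) <= om.
  have c0 : 0 < om / (2 * M + 1) by rewrite divr_gt0// ltr_wpDl// mulr_ge0.
  have [d2 d20 h] := heine_cantor_itv modulus_within_continuous c0.
  exists d2 => // s s' sI s'I ss'.
  apply: (@le_trans _ _ ((2 * M + 1) * (om / (2 * M + 1)))); last first.
    by rewrite mulrC divfK// gt_eqF// ltr_wpDl// mulr_ge0.
  rewrite mulrA [M * 2]mulrC.
  apply: (@le_trans _ _ (2 * M * (om / (2 * M + 1)))).
    apply: ler_wpM2l; first exact: mulr_ge0.
    exact: (le_trans (ler_norm _) (h s s' sI s'I ss')).
  by rewrite ler_wpM2r ?ltW// ltrDl.
(* The other half of [d1] is the slack to the left of [p i], so that every point involved stays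
   within [d1] of the tag. *)
exists (Num.min (d1 / 2) d2); first by rewrite lt_min divr_gt0.
move=> s tg sP p h.
have pmem i : (i <= size s)%N -> 0 <= p i /\ p i <= t.
  by move=> is_; split; [exact: itv_partition_nth_ge sP|exact: itv_partition_nth_le sP].
have -> : J t = \sum_(0 <= i < size s) (J (p i.+1) - J (p i)).
  rewrite (telescope_sumr (fun i => J (p i)))// /p /= limit_J0 subr0.
  by rewrite (itv_partition_nth_size _ sP).
rewrite -sumrB (le_lt_trans (enorm_sum _ _ _))//.
apply: (le_lt_trans _ omW).
apply: (@le_trans _ _ (2 * om * (w t - w 0))); last first.
  apply: ler_wpM2l; first by rewrite mulr_ge0// ltW.
  by rewrite /W lerD2r (variation_clock_le zw).
have <- : \sum_(0 <= i < size s) (2 * om * (w (p i.+1) - w (p i))) =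
    2 * om * (w t - w 0).
  rewrite -mulr_sumr (telescope_sumr (fun i => w (p i)))// /p.
  by rewrite (itv_partition_nth_size _ sP).
rewrite big_nat [leRHS]big_nat; apply: ler_sum => i /andP[_ is_].
have [mesh /andP[t1 t2]] := h i is_.
have [pi0 pit] := pmem i (ltnW is_); have [pi1 pi1t] := pmem i.+1 is_.
have pp := le_trans t1 t2.
have piT := le_trans pit tT; have pi1T := le_trans pi1t tT.
move: mesh; rewrite lt_min => /andP[mesh1 mesh2].
have d12 : 0 < d1 / 2 by rewrite divr_gt0.
have tgI : tg i \in `[0, T] by rewrite in_itv /= (le_trans pi0 t1) (le_trans t2).
rewrite enormB.
apply: (le_trans (limit_RS_local pi0 t1 t2 pi1T (ltW om0) d12 _)).
  move=> u x uI u1 u2; apply: Fd1 => //.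
  by rewrite ltr_norml; apply/andP; split; lra.
have [pI p1I] := itv_subset_mem pi0 pp pi1T.
rewrite ler_wpM2r ?subr_ge0 ?(variation_clock_le zw)//.
rewrite (_ : 2 * om = om + om); last by ring.
by rewrite lerD2l; apply: md2 => //; rewrite ger0_norm ?subr_ge0.
Qed.

Lemma cvg_right_itv (f : R -> R) (s : R) : {within `[0, T], continuous f} ->
  0 <= s -> s < T -> f t @[t --> s^'+] --> f s.
Proof.
move=> fc s0 sT.
have sI : s \in `[0, T] by rewrite in_itv /= s0 ltW.
have /subspace_continuousP/(_ s sI) fs := fc.
move=> P /fs wP.
have {}wP : nbhs s [set y | y \in `[0, T] -> P (f y)] := wP.
have lT : nbhs s [set y | y < T] by exact: lt_nbhsl.
apply: (@filterS2 _ (nbhs s) _ _ _ _ _ wP lT) => y h yT sy.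
by apply: h; rewrite in_itv /= (le_trans s0) ?ltW.
Qed.

(* Dividing the energy inequality on [s, t] by [v t - v s] and letting [t]
   decrease to [s] gives the monotonicity test against every point of the graph
   of [A s]; maximality concludes. *)
Lemma limit_inclusion (s lam : R) (g : E) : maximal_monotone (A s) ->
  0 <= s -> s < T ->
  (forall i, (v t - v s)^-1 * (Y t i 0 - Y s i 0) @[t --> s^'+] --> g i 0) ->
  (v t - v s)^-1 * (t - s) @[t --> s^'+] --> lam ->
  A s (Y s) (- g - lam *: J s).
Proof.
move=> Amax s0 sT gc lc; apply: maximal_monotoneP => // xi eta Asxe.
have gc' : (v t - v s)^-1 *: (Y t - Y s) @[t --> s^'+] --> g.
  apply: cvg_cV => i; under eq_fun do rewrite !mxE; exact: gc.
have right0 (f : R -> R) : {within `[0, T], continuous f} ->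
    f t - f s @[t --> s^'+] --> 0.
  move=> fc; rewrite -(subrr (f s)).
  by apply: cvgB; [exact: cvg_right_itv|exact: cvg_cst].
pose rhs t := dotv eta (xi - Y s) + (1 + K + enorm eta) * (r t - r s) +
     (enorm eta * K + K * K) * (v t - v s) +
     K * (enorm xi + K) * (w t - w s) +
  (v t - v s)^-1 * (t - s) * dotv (J s) (xi - Y s).
have rhsc : rhs t @[t --> s^'+] -->
    dotv eta (xi - Y s) + (1 + K + enorm eta) * 0 + (enorm eta * K + K * K) * 0 +
    K * (enorm xi + K) * 0 + lam * dotv (J s) (xi - Y s).
  apply: cvgD; last by apply: cvgM; [exact: lc|exact: cvg_cst].
  apply: cvgD; last by apply: cvgM; [exact: cvg_cst|exact: right0 w_cont].
  apply: cvgD; last by apply: cvgM; [exact: cvg_cst|exact: right0 clock_within_continuous].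
  apply: cvgD; first exact: cvg_cst.
  by apply: cvgM; [exact: cvg_cst|exact: right0 r_cont].
have lhsc : dotv ((v t - v s)^-1 *: (Y t - Y s)) (Y s - xi) @[t --> s^'+] -->
    dotv g (Y s - xi).
  by apply: cvg_dotv; [exact: gc'|exact: cvg_cst].
have : dotv g (Y s - xi) <= dotv eta (xi - Y s) + (1 + K + enorm eta) * 0 +
    (enorm eta * K + K * K) * 0 + K * (enorm xi + K) * 0 +
    lam * dotv (J s) (xi - Y s).
  apply: (ler_cvg lhsc rhsc).
  near=> t.
  have st : s < t by near: t; exact: nbhs_right_gt.
  have tT : t < T by near: t; exact: nbhs_right_lt.
  have := limit_energy s0 (ltW st) (ltW tT) Asxe.
  have dv : 0 < v t - v s by rewrite subr_gt0; exact: (clock_ltr r_nd s0 st (ltW tT)).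
  set E0 := (X in _ <= _ * X + _) => h.
  (* Expanding around [Y s] and dropping half the square of [Y t - Y s] leaves a left-hand side
     linear in the difference quotient. *)
  have h2 : dotv (Y t - Y s) (Y s - xi) <= (v t - v s) * E0 +
      (t - s) * dotv (J s) (xi - Y s).
    apply: (le_trans _ h); have := dotv_ge0 (Y t - Y s).
    rewrite !dotvE (dotvC xi (Y s)) (dotvC xi (Y t)) (dotvC (Y s) (Y t)); lra.
  rewrite dotvZl; apply: (le_trans (ler_wpM2l _ h2)).
    by rewrite invr_ge0 ltW.
  by rewrite mulrDr mulrA mulVf ?gt_eqF// mul1r mulrA /rhs.
rewrite !mulr0 !addr0 !dotvE; lra.
Unshelve. all: by end_near. Qed.

End limit_properties.
End euler_limit.

(** * Bounded variation and conclusion *)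

Lemma bounded_variation_vec_of_incr (R : realType) n (T : R) (f : R -> 'cV[R]_n)
    (g : R -> R) :
  (forall s t, 0 <= s -> s <= t -> t <= T -> enorm (f t - f s) <= g t - g s) ->
  bounded_variation_vec 0 T f.
Proof.
move=> fg; exists (g T - g 0) => s sP; cbv zeta; set p := nth T (0 :: s).
have -> : g T - g 0 = \sum_(0 <= i < size s) (g (p i.+1) - g (p i)).
  by rewrite (telescope_sumr (fun i => g (p i)))// /p (itv_partition_nth_size _ sP).
rewrite big_nat [leRHS]big_nat; apply: ler_sum => i /andP[_ is_].
have [ps lastp] := sP.
have pp : p i <= p i.+1.
  have := nondecreasing_fun_itv_partition (f := id) _ sP is_.
  by rewrite /=; apply => x y _ _.
apply: fg => //; last exact: itv_partition_nth_le sP.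
by apply: itv_partition_nth_ge sP; exact: ltnW.
Qed.

Theorem theorem4p3 (R : realType) (d e : nat) (T : R) (T_gt0 : 0 < T)
  (A : R -> operator R e)
  (A_max : forall t, t \in `[0, T] -> maximal_monotone (A t))
  (r : R -> R)
  (r_cont : {within `[0, T], continuous r})
  (r_nd : {in `[0, T] &, nondecreasing_fun r})
  (r_ge0 : forall t, t \in `[0, T] -> 0 <= r t)
  (r0 : r 0 = 0)
  (H1 : forall s t, 0 <= s -> s <= t -> t <= T ->
     (dis (A t) (A s) <= (r t - r s)%:E)%E)
  (c : R) (c_ge0 : 0 <= c)
  (H2 : forall t x, t \in `[0, T] -> domain (A t) x ->
     enorm (minimal_section (A t) x) <= c * (1 + enorm x))
  (z : R -> 'cV[R]_d) (z_BVC : BVC 0 T z)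
  (b : R -> 'cV[R]_e -> 'M[R]_(e, d))
  (b_cont : {within `[0, T] `*` [set: 'cV[R]_e],
     continuous (fun p : R * 'cV[R]_e => b p.1 p.2)})
  (M : R) (M_ge0 : 0 <= M)
  (b_bound : forall t x, t \in `[0, T] -> opnorm (b t x) <= M)
  (b_lip : forall t x y, t \in `[0, T] ->
     opnorm (b t x - b t y) <= M * enorm (x - y))
  (a : 'cV[R]_e) (a_dom : domain (A 0) a) :
  exists X Y J dY : R -> 'cV[R]_e,
    [/\ BVC 0 T X,
        BVC 0 T Y,
        forall t, t \in `[0, T] ->
          is_RS_integral (fun tau => b tau (X tau)) z 0 t (J t) &
        is_density T (nu T_gt0 r_cont r_nd) Y dY] /\
    [/\ X 0 = a,
        Y 0 = a,
        forall t, t \in `[0, T] -> X t = J t + Y t &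
        {ae nu T_gt0 r_cont r_nd, forall t, t \in `[0, T] ->
          [set y + dlambda_dnu T_gt0 r_cont r_nd t *: J t | y in A t (Y t)]
            (- dY t)}].
Proof.
have [w w_cont zw] := BVC_clock T_gt0 z_BVC.
pose K := euler_bound T r c w M a.
have scheme N := euler_scheme_exists T_gt0 A_max r_nd z b a N.
have /choice[Yn /choice[Jn /choice[yn schemeP]]] := scheme.
have bounds N := euler_scheme_bounds T_gt0 A_max r_nd H1 c_ge0 H2 zw M_ge0 b_bound
  a_dom (schemeP N).
have K0 : 0 <= K := euler_bound_ge0 T_gt0 r c_ge0 zw M_ge0 a.
have stepP N i iN := proj1 (bounds N) i iN.
have boundP N i iN := proj2 (bounds N) i iN.
have [U [Y [J [UP sU YJlim]]]] := euler_limit_exists T_gt0 boundP.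
have Ylim t tT := proj1 (YJlim t tT).
have Jlim t tT := proj2 (YJlim t tT).
have z_cont := proj1 z_BVC.
pose v t := t + r t.
have Y_incr s t : 0 <= s -> s <= t -> t <= T -> enorm (Y t - Y s) <= K * v t - K * v s.
  move=> s0 st tT; rewrite -mulrBr.
  exact: (limit_Y_incr T_gt0 r_cont stepP sU Ylim s0 st tT).
have Kv_cont : {within `[0, T], continuous (fun t => K * v t)}.
  by move=> x; apply: (cvgM (F := nbhs x));
    [exact: cvg_cst|exact: (clock_within_continuous r_cont)].
have Y_cont := continuous_of_incr Kv_cont Y_incr.
have X_incr := limit_X_incr (UP := UP) T_gt0 r_cont w_cont stepP sU Ylim Jlim.
have X_continuous := limit_X_continuous (UP := UP) T_gt0 r_cont w_cont stepP sU Ylim Jlim.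
(* Each coordinate of [Y] is Lipschitz with constant [K] in the time [v], hence has a density with
   respect to [nu]. *)
have density i : exists g : R -> R,
    (nu T_gt0 r_cont r_nd).-integrable `[0, T] (EFin \o g) /\
    forall s t, 0 <= s -> s <= t -> t <= T ->
      \int[nu T_gt0 r_cont r_nd]_(x in `]s, t]) g x = Y t i 0 - Y s i 0.
  have [||g gint gE] := nu_lipschitz_density T_gt0 r_cont r_nd (y := fun t => Y t i 0) K0.
  - by move=> x; apply: (cvg_cV_coord (F := nbhs x)); exact: Y_cont.
  - move=> s t s0 st tT; rewrite mulrBr.
    apply: le_trans (Y_incr s t s0 st tT).
    by have := normr_coord_le_enorm (Y t - Y s) i; rewrite !mxE.
  - by exists g.
have /choice[g gP] := density.
exists (fun t => J t + Y t), Y, J, (fun t => \col_i g i t).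
have Y0 := limit_Y0 (UP := UP) T_gt0 schemeP Ylim.
have J0 := limit_J0 (UP := UP) T_gt0 schemeP Jlim.
split; split=> //.
- split; first exact: X_continuous.
  exact: (bounded_variation_vec_of_incr (g := fun t => K * v t + K * w t) X_incr).
- split; first exact: Y_cont.
  exact: (bounded_variation_vec_of_incr (g := fun t => K * v t) Y_incr).
- exact: (limit_RS T_gt0 r_cont r_nd z_cont w_cont zw b_cont M_ge0 b_lip K0
    schemeP stepP sU Ylim Jlim).
- split=> [i|t].
    rewrite (_ : (fun s => _) = EFin \o g i); first by have [] := gP i.
    by apply/funext => s; rewrite mxE.
  rewrite in_itv /= => /andP[t0 tT]; apply/colP => i; rewrite !mxE.
  rewrite (_ : (fun s => _) = g i); last by apply/funext => s; rewrite mxE.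
  by have [_ ->] := gP i; rewrite ?subrKC//; rewrite addrC subrK.
- by rewrite J0 add0r.
have ae_filter := ae_filter_ringOfSetsType (nu T_gt0 r_cont r_nd).
(* The coordinates are finitely many, so their exceptional sets join into one null set. *)
have diffY : {ae nu T_gt0 r_cont r_nd, forall t, forall i, t \in `[0, T[ ->
    ((t' + r t') - (t + r t))^-1 *
      \int[nu T_gt0 r_cont r_nd]_(s in `]t, t']) g i s @[t' --> t^'+] --> g i t}.
  by apply: filter_forall => i; exact: (nu_differentiation (proj1 (gP i))).
have diffl := nu_differentiation (dlambda_dnu_integrable T_gt0 r_cont r_nd).
(* Right derivatives are taken only before [T]. *)
have aeT : {ae nu T_gt0 r_cont r_nd, forall t, t <> T}.
  exists [set T]; split=> //; first exact: nu_setT.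
  by move=> t /= /contrapT.
apply: filterS3 aeT diffl diffY => t tneT dl dY tI.
have [t0 tT] : 0 <= t /\ t <= T by move: tI; rewrite in_itv /= => /andP.
have tltT : t < T by rewrite lt_neqAle tT andbT; apply/eqP.
have tI' : t \in `[0, T[ by rewrite in_itv /= t0.
exists (- (\col_i g i t) - dlambda_dnu T_gt0 r_cont r_nd t *: J t); last by rewrite subrK.
apply: (limit_inclusion T_gt0 r_cont r_nd H1 w_cont zw K0 schemeP stepP boundP sU
  Ylim Jlim (A_max t tI) t0 tltT) => [i|].
- rewrite mxE; apply: cvg_trans (dY i tI'); apply: near_eq_cvg; near=> t'.
  have tt' : t < t' by near: t'; exact: nbhs_right_gt.
  have t'T : t' < T by near: t'; exact: nbhs_right_lt.
  by have [_ ->] := gP i; rewrite // ltW.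
- apply: cvg_trans (dl tI'); apply: near_eq_cvg; near=> t'.
  have tt' : t < t' by near: t'; exact: nbhs_right_gt.
  have t'T : t' < T by near: t'; exact: nbhs_right_lt.
  by rewrite integral_dlambda_dnu ?(ltW tt') ?(ltW t'T).
Unshelve. all: by end_near. Qed.
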